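(* Let $P\bowtie G$ be a Zappa-Szép product of a semigroup $P$ and a group $G$, let $\mathcal{A}$ be a unital C*-algebra, let $X=\bigsqcup_{p\in P}X_p$ be a product system over $P$ with coefficient $\mathcal{A}$, and let $\beta$ be a homogeneous Zappa-Szép action of $G$ on $X$. Let $\mathfrak{A}=\mathcal{A}\rtimes_\beta G$ and, for $p\in P$, let $Z_p$ be the $\mathfrak{A}$-correspondence defined in the context. Then $Z=\bigsqcup_{p\in P}Z_p$ is a product system over $P$ with coefficient $\mathfrak{A}$ (where $Z_e$ is identified with $\mathfrak{A}$ via $a\otimes g\mapsto au_g$), where the multiplication $Z_p\times Z_q\to Z_{pq}$ is given by $$(x_p\otimes g,\;y_q\otimes h)\mapsto x_p\beta_g(y_q)\otimes g|_q h\qquad (g,h\in G,\ x_p\in X_p,\ y_q\in X_q).$$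
   Context: Semigroups and groups are discrete, and every semigroup has an identity, written $e$ (the identity of $G$ is also written $e$). Zappa-Szép product. One is given a left action $G\times P\to P$, $(g,p)\mapsto g\cdot p$, and a map $P\times G\to G$, $(p,g)\mapsto g|_p$, such that for all $g,h\in G$, $p,q\in P$: $e\cdot p=p$; $(gh)\cdot p=g\cdot(h\cdot p)$; $g\cdot e=e$; $g|_e=g$; $g\cdot(pq)=(g\cdot p)(g|_p\cdot q)$; $g|_{pq}=(g|_p)|_q$; $e|_p=e$; $(gh)|_p=g|_{h\cdot p}\,h|_p$. Then $P\bowtie G=P\times G$ with product $(p,g)(q,h)=(p(g\cdot q),\,g|_q h)$ is a semigroup with identity $(e,e)$. Product system. An $\mathcal{A}$-correspondence is a right Hilbert $\mathcal{A}$-module with a left action of $\mathcal{A}$ by adjointable operators. A product system over $P$ with coefficient $\mathcal{A}$ is $X=\bigsqcup_{p\in P}X_p$, with each $X_p$ an $\mathcal{A}$-correspondence, with an associative multiplication $X_p\times X_q\to X_{pq}$ such that (1) $X_e=\mathcal{A}$ as an $\mathcal{A}$-correspondence; (2) for all $p,q\in P$ the multiplication extends to a unitary $M_{p,q}:X_p\otimes X_q\to X_{pq}$ (interior tensor product over $\mathcal{A}$); (3) the left and right actions of $\mathcal{A}$ on $X_p$ coincide with the multiplications $X_e\times X_p\to X_p$ and $X_p\times X_e\to X_p$. Zappa-Szép action of $G$ on $X$: a collection $\beta=\{\beta_g\}_{g\in G}$ of maps on $X$ such that (A1) for each $p\in P$, $g\in G$, $\beta_g$ restricts to a $\mathbb{C}$-linear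 map $X_p\to X_{g\cdot p}$; (A2) $\beta_g\circ\beta_h=\beta_{gh}$; (A3) $\beta_e$ is the identity; (A4) each $\beta_g$ is a $*$-automorphism of $X_e=\mathcal{A}$; (A5) $\beta_g(xy)=\beta_g(x)\beta_{g|_p}(y)$ for $x\in X_p$, $y\in X_q$; (A6) $\langle\beta_g(x),\beta_g(y)\rangle=\beta_{g|_p}(\langle x,y\rangle)$ for $x,y\in X_p$. It is homogeneous if $g\cdot p=p$ for all $g\in G$, $p\in P$. The correspondences $Z_p$. In the homogeneous case, $(\mathcal{A},G,\beta)$ is a C*-dynamical system; $\mathfrak{A}=\mathcal{A}\rtimes_\beta G$ is its universal (full) crossed product, generated by $\mathcal{A}$ and unitaries $u_g$ ($g\in G$) with $u_ga=\beta_g(a)u_g$. For $p\in P$ put $Z_p^0=c_{00}(G,X_p)=\operatorname{span}\{x\otimes g:x\in X_p,\ g\in G\}$ (finitely supported functions), with $$(au_h)(x\otimes g)=(a\beta_h(x))\otimes h|_p g,\qquad (x\otimes g)(au_h)=(x\beta_g(a))\otimes gh,$$ $$\langle x\otimes g,y\otimes h\rangle=\beta_{g^{-1}}(\langle x,y\rangle)u_{g^{-1}h}=u_{g^{-1}}\langle x,y\rangle u_h\in\mathfrak{A},$$ extended by (sesqui)linearity. $Z_p$ is the completion of $Z_p^0$ in the norm $\|\xi\|=\|\langle\xi,\xi\rangle\|^{1/2}$, with the left and right actions extended by continuity to $\mathfrak{A}$; it is an $\mathfrak{A}$-correspondence. The multiplication on $Z$ is understood as extended bilinearly and continuously from elementary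 tensors. *)

(* Defs.v *)
From HB Require Import structures.
From mathcomp Require Import all_boot all_order all_algebra complex.
From mathcomp Require Import all_classical all_reals all_analysis.

Set Implicit Arguments.
Unset Strict Implicit.
Unset Printing Implicit Defensive.

Import Order.TTheory GRing.Theory Num.Theory numFieldNormedType.Exports.

Local Open Scope classical_set_scope.
Local Open Scope ring_scope.

Reserved Notation "a ** b" (at level 40, left associativity).

(* Unital C*-algebras; norms take their values in the nonnegative reals inside
   R[i].  The product is a field of this mixin, rather than the one of an
   algType, because the hierarchies of MathComp and MathComp-Analysis have no
   join of rings and normed modules below numDomainType. *)
HB.mixin Record isCStarAlgebra (R : realType) A
    of CompleteNormedModule R[i] A := {
  cmul : A -> A -> A ;
  cone : A ;
  star : A -> A ;
  cmulA : forall a b c : A, cmul a (cmul b c) = cmul (cmul a b) c ;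
  cmul1l : forall a : A, cmul cone a = a ;
  cmul1r : forall a : A, cmul a cone = a ;
  cmulDl : forall a b c : A, cmul (a + b) c = cmul a c + cmul b c ;
  cmulDr : forall a b c : A, cmul a (b + c) = cmul a b + cmul a c ;
  cmulZl : forall (k : R[i]) (a b : A), cmul (k *: a) b = k *: cmul a b ;
  cmulZr : forall (k : R[i]) (a b : A), cmul a (k *: b) = k *: cmul a b ;
  starD : forall a b : A, star (a + b) = star a + star b ;
  starZ : forall (k : R[i]) (a : A), star (k *: a) = Num.conj k *: star a ;
  starM : forall a b : A, star (cmul a b) = cmul (star b) (star a) ;
  starK : forall a : A, star (star a) = a ;
  cnormM : forall a b : A, `|cmul a b| <= `|a| * `|b| ;
  cnorm_star : forall a : A, `|cmul (star a) a| = `|a| ^+ 2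
}.

#[short(type="cstarAlgType")]
HB.structure Definition CStarAlgebra (R : realType) :=
  {A of isCStarAlgebra R A & CompleteNormedModule R[i] A}.

Notation "a ** b" := (cmul a b) : ring_scope.

Definition cpositive (R : realType) (A : cstarAlgType R) (a : A) : Prop :=
  exists b : A, a = star b ** b.

(* Right Hilbert A-modules; the inner product is linear in its second
   variable. *)
HB.mixin Record isHilbertModule (R : realType) (A : cstarAlgType R) E
    of CompleteNormedModule R[i] E := {
  ract : E -> A -> E ;
  dot : E -> E -> A ;
  ractDl : forall (x y : E) (a : A), ract (x + y) a = ract x a + ract y a ;
  ractDr : forall (x : E) (a b : A), ract x (a + b) = ract x a + ract x b ;
  ractZl : forall (k : R[i]) (x : E) (a : A), ract (k *: x) a = k *: ract x a ;
  ractZr : forall (k : R[i]) (x : E) (a : A), ract x (k *: a) = k *: ract x a ;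
  ractM : forall (x : E) (a b : A), ract x (a ** b) = ract (ract x a) b ;
  ract1 : forall x : E, ract x cone = x ;
  dotDr : forall x y z : E, dot x (y + z) = dot x y + dot x z ;
  dotZr : forall (k : R[i]) (x y : E), dot x (k *: y) = k *: dot x y ;
  dot_ract : forall (x y : E) (a : A), dot x (ract y a) = dot x y ** a ;
  dot_star : forall x y : E, star (dot x y) = dot y x ;
  dot_ge0 : forall x : E, cpositive (dot x x) ;
  dot_norm : forall x : E, `|x| ^+ 2 = `|dot x x|
}.

#[short(type="hilbModType")]
HB.structure Definition HilbertModule (R : realType) (A : cstarAlgType R) :=
  {E of isHilbertModule R A E & CompleteNormedModule R[i] E}.

(* lact_adj makes the left action a *-homomorphism into the adjointable
   operators (which are automatically A-linear). *)
HB.mixin Record isCorrespondence (R : realType) (A : cstarAlgType R) E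
    of HilbertModule R A E := {
  lact : A -> E -> E ;
  lactDl : forall (a b : A) (x : E), lact (a + b) x = lact a x + lact b x ;
  lactZl : forall (k : R[i]) (a : A) (x : E), lact (k *: a) x = k *: lact a x ;
  lactM : forall (a b : A) (x : E), lact (a ** b) x = lact a (lact b x) ;
  lact_adj : forall (a : A) (x y : E),
    dot (lact a x) y = dot x (lact (star a) y) :> A
}.

#[short(type="corrType")]
HB.structure Definition Correspondence (R : realType) (A : cstarAlgType R) :=
  {E of isCorrespondence R A E & HilbertModule R A E}.

(* A as a correspondence over itself: <a, b> = a^* b. *)
Definition selfcorr (R : realType) (A : cstarAlgType R) : Type := A.

Section SelfCorrespondence.
Context {R : realType} {A : cstarAlgType R}.

HB.instance Definition _ := CompleteNormedModule.on (selfcorr A).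

Fact selfcorr_dot_ge0 (x : A) : cpositive (star x ** x).
Proof. by exists x. Qed.

Fact selfcorr_dot_ract (x y a : A) : star x ** (y ** a) = (star x ** y) ** a.
Proof. exact: cmulA. Qed.

Fact selfcorr_dot_star (x y : A) : star (star x ** y) = star y ** x.
Proof. by rewrite starM starK. Qed.

Fact selfcorr_lactM (a b x : A) : (a ** b) ** x = a ** (b ** x).
Proof. by rewrite cmulA. Qed.

Fact selfcorr_lact_adj (a x y : A) :
  star (a ** x) ** y = star x ** (star a ** y).
Proof. by rewrite starM cmulA. Qed.

HB.instance Definition _ := isHilbertModule.Build R A (selfcorr A)
  (ract := fun x a : A => x ** a) (dot := fun x y : A => star x ** y)
  cmulDl cmulDr cmulZl (fun k x a => cmulZr k x a) cmulA cmul1r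
  (fun x => cmulDr (star x)) (fun k x => cmulZr k (star x))
  selfcorr_dot_ract selfcorr_dot_star selfcorr_dot_ge0
  (fun x => esym (cnorm_star x)).

HB.instance Definition _ := isCorrespondence.Build R A (selfcorr A)
  (lact := fun a x : A => a ** x)
  cmulDl cmulZl selfcorr_lactM selfcorr_lact_adj.

End SelfCorrespondence.

Section HilbertModules.
Context {R : realType} {A : cstarAlgType R}.

Definition is_adjoint (E F : hilbModType A) (T : E -> F) (S : F -> E) : Prop :=
  forall x y, dot (T x) y = dot x (S y) :> A.

Definition unitary (E F : hilbModType A) (U : E -> F) : Prop :=
  exists V : F -> E, [/\ is_adjoint U V, cancel U V & cancel V U].

Definition corr_iso (E F : corrType A) (U : E -> F) : Prop :=
  unitary U /\ forall (a : A) (x : E), U (lact a x) = lact a (U x).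

Definition lin_span (V : lmodType R[i]) (S : set V) : set V :=
  [set v | exists (n : nat) (k : 'I_n -> R[i]) (w : 'I_n -> V),
     (forall i, S (w i)) /\ v = \sum_i k i *: w i].

Definition total_set (V : normedModType R[i]) (S : set V) : Prop :=
  closure (lin_span S) = setT.

Definition continuous_bilinear (E F D : normedModType R[i])
    (m : E -> F -> D) : Prop :=
  [/\ forall x, linear (m x), forall y, linear (fun x => m x y) &
      continuous (fun w : E * F => m w.1 w.2)].

(* (T, t) is a model of the interior tensor product E (x)_A F: the Hilbert
   module T, with t x y = x (x) y, is the completion of the balanced algebraic
   tensor product for <x (x) y, x' (x) y'> = <y, <x, x'> y'>.  Such a model is
   unique up to a unique unitary. *)
Record interior_tensor (E F : corrType A) (T : hilbModType A)
    (t : E -> F -> T) : Prop := InteriorTensor {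
  tensor_linl : forall y, linear (fun x => t x y) ;
  tensor_linr : forall x, linear (t x) ;
  tensor_balanced : forall (x : E) (a : A) (y : F),
    t (ract x a) y = t x (lact a y) ;
  tensor_ract : forall (x : E) (y : F) (a : A),
    t x (ract y a) = ract (t x y) a ;
  tensor_dot : forall x y x' y',
    dot (t x y) (t x' y') = dot y (lact (dot x x' : A) y') :> A ;
  tensor_total : total_set [set w | exists x y, w = t x y]
}.

Definition extends_to_unitary (E F D : corrType A) (m : E -> F -> D) : Prop :=
  (exists (T : hilbModType A) (t : E -> F -> T), interior_tensor t) /\
  (forall (T : hilbModType A) (t : E -> F -> T), interior_tensor t ->
     exists U : T -> D, unitary U /\ forall x y, U (t x y) = m x y).

End HilbertModules.

(* act g p is g . p, and res p g is g|_p. *)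
Record zappa_szep (P : monoidType) (G : groupType)
    (act : G -> P -> P) (res : P -> G -> G) : Prop := ZappaSzep {
  zs_act1 : forall p, act 1%g p = p ;
  zs_actM : forall g h p, act (g * h)%g p = act g (act h p) ;
  zs_act_e : forall g, act g 1%g = 1%g ;
  zs_res_e : forall g, res 1%g g = g ;
  zs_act_mul : forall g p q, act g (p * q)%g = (act g p * act (res p g) q)%g ;
  zs_res_mul : forall g p q, res (p * q)%g g = res q (res p g) ;
  zs_res1 : forall p, res p 1%g = 1%g ;
  zs_resM : forall g h p, res p (g * h)%g = (res (act h p) g * res p h)%g
}.

Definition homogeneous (P : monoidType) (G : groupType) (act : G -> P -> P) :=
  forall g p, act g p = p.

(* The element x of the fibre X p, seen in the disjoint union of the fibres.
   Equations between elements of X p and X q with p = q only provably are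
   stated in this disjoint union. *)
Definition tot (R : realType) (A : cstarAlgType R) (P : Type)
    (X : P -> corrType A) (p : P) (x : X p) : {p : P & X p} :=
  existT (fun p => X p : Type) p x.
Arguments tot {R A P} X {p} x.

Section ProductSystems.
Context {R : realType} {A : cstarAlgType R} {P : monoidType} {G : groupType}.

(* The identification X_e = A is an isomorphism of correspondences
   unit : A -> X_e. *)
Record product_system (X : P -> corrType A)
    (mul : forall p q, X p -> X q -> X (p * q)%g)
    (unit : selfcorr A -> X 1%g) : Prop := ProductSystem {
  ps_assoc : forall p q r (x : X p) (y : X q) (z : X r),
    tot X (mul _ _ x (mul _ _ y z)) = tot X (mul _ _ (mul _ _ x y) z) ;
  ps_unit : corr_iso unit ;
  ps_unitary : forall p q, extends_to_unitary (mul p q) ;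
  ps_lact : forall p (a : A) (x : X p),
    tot X (mul _ _ (unit a) x) = tot X (lact a x) ;
  ps_ract : forall p (x : X p) (a : A),
    tot X (mul _ _ x (unit a)) = tot X (ract x a)
}.

Record star_hom (B D : cstarAlgType R) (f : B -> D) : Prop := StarHom {
  star_hom_linear : linear f ;
  star_hom_mul : forall a b, f (a ** b) = f a ** f b ;
  star_hom_one : f cone = cone ;
  star_hom_star : forall a, f (star a) = star (f a)
}.

(* alpha g is the restriction of beta_g to X_e, read on A through unit. *)
Record zs_action (act : G -> P -> P) (res : P -> G -> G)
    (X : P -> corrType A) (mul : forall p q, X p -> X q -> X (p * q)%g)
    (unit : selfcorr A -> X 1%g)
    (beta : forall g p, X p -> X (act g p)) (alpha : G -> A -> A) : Prop :=
    ZSAction {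
  zsa_linear : forall g p, linear (beta g p) ;
  zsa_comp : forall g h p (x : X p),
    tot X (beta g _ (beta h p x)) = tot X (beta (g * h)%g p x) ;
  zsa_id : forall p (x : X p), tot X (beta 1%g p x) = tot X x ;
  zsa_coef : forall g (a : A), tot X (beta g _ (unit a)) = tot X (unit (alpha g a)) ;
  zsa_aut : forall g, star_hom (alpha g) /\ bijective (alpha g) ;
  zsa_mul : forall g p q (x : X p) (y : X q),
    tot X (beta g _ (mul _ _ x y)) =
    tot X (mul _ _ (beta g p x) (beta (res p g) q y)) ;
  zsa_dot : forall g p (x y : X p),
    dot (beta g p x) (beta g p y) = alpha (res p g) (dot x y) :> A
}.

Record covariant (alpha : G -> A -> A) (B : cstarAlgType R)
    (pi : A -> B) (v : G -> B) : Prop := Covariant {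
  cov_hom : star_hom pi ;
  cov_one : v 1%g = cone ;
  cov_mul : forall g h, v (g * h)%g = v g ** v h ;
  cov_star : forall g, star (v g) = v g^-1%g ;
  cov_eq : forall g a, v g ** pi a = pi (alpha g a) ** v g
}.

Record closed_star_subalgebra (B : cstarAlgType R) (S : set B) : Prop :=
    ClosedStarSubalgebra {
  css_closed : closed S ;
  css_lin : forall (k : R[i]) a b, S a -> S b -> S (k *: a + b) ;
  css_mul : forall a b, S a -> S b -> S (a ** b) ;
  css_star : forall a, S a -> S (star a)
}.

(* The full crossed product: the C*-algebra generated by a universal covariant
   pair (iota, u). *)
Record crossed_product (alpha : G -> A -> A) (AG : cstarAlgType R)
    (iota : A -> AG) (u : G -> AG) : Prop := CrossedProduct {
  cp_covariant : covariant alpha iota u ;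
  cp_generated : forall S : set AG, closed_star_subalgebra S ->
    (forall a, S (iota a)) -> (forall g, S (u g)) -> S = setT ;
  cp_universal : forall (B : cstarAlgType R) (pi : A -> B) (v : G -> B),
    covariant alpha pi v ->
    exists f : AG -> B,
      [/\ star_hom f, forall a, f (iota a) = pi a & forall g, f (u g) = v g]
}.

(* Z p is the completion of c_00(G, X p): a linear map out of c_00(G, X p) is
   a family of linear maps z p ^~ g out of X p, where z p x g = x (x) g. *)
Record crossed_correspondences (act : G -> P -> P) (res : P -> G -> G)
    (X : P -> corrType A) (beta : forall g p, X p -> X (act g p))
    (alpha : G -> A -> A)
    (AG : cstarAlgType R) (iota : A -> AG) (u : G -> AG)
    (Z : P -> corrType AG) (z : forall p, X p -> G -> Z p) : Prop :=
    CrossedCorrespondences {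
  zc_linear : forall p g, linear (fun x : X p => z p x g) ;
  zc_total : forall p, total_set [set w | exists x g, w = z p x g] ;
  zc_lact : forall p (a : A) h (x : X p) g,
    tot Z (lact (iota a ** u h) (z p x g)) =
    tot Z (z _ (lact a (beta h p x)) (res p h * g)%g) ;
  zc_ract : forall p (x : X p) g (a : A) h,
    ract (z p x g) (iota a ** u h) = z p (ract x (alpha g a)) (g * h)%g ;
  zc_dot : forall p (x y : X p) g h,
    dot (z p x g) (z p y h) =
    iota (alpha g^-1%g (dot x y)) ** u (g^-1 * h)%g :> AG
}.

End ProductSystems.

(* Main.v *)
Require Import Defs.
From HB Require Import structures.
From mathcomp Require Import all_boot all_order all_algebra complex.
From mathcomp Require Import all_classical all_reals all_analysis.
From mathcomp Require Import ring.

(* On elementary tensors,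
     <(x (x) g)(y (x) h), (x' (x) g')(y' (x) h')>
       = <y (x) h, <x (x) g, x' (x) g'> (y' (x) h')>
   by a direct computation with the axioms.  Since the elementary tensors are
   total, the multiplication therefore extends to Z_p x Z_q by two successive
   bounded extensions, first in y (x) h and then in x (x) g, and Z_pq itself is
   a model of the interior tensor product.  Associativity and the unit laws are
   checked on elementary tensors and follow by density; likewise
   a u_g |-> a (x) g preserves inner products and extends to a unitary
   AG -> Z_e.  The extensions need the left action to be bounded, which is
   obtained with a constant from the fact that every element of a unital
   C*-algebra is a combination of at most four unitaries. *)

Set Implicit Arguments.
Unset Strict Implicit.
Unset Printing Implicit Defensive.

Import Order.TTheory GRing.Theory Num.Theory numFieldNormedType.Exports.

Local Open Scope classical_set_scope.
Local Open Scope ring_scope.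

(** * Density and bounded linear maps *)

Section LinearCombinations.
Context {R : realType}.
Local Notation C := R[i].

(** The list records indices instead of vectors, so that one list can be evaluated on two families
    [s] and [t], and sums of combinations become concatenations. *)
Definition comb (V : lmodType C) (I : Type) (s : I -> V) (l : seq (C * I)) : V :=
  \sum_(ki <- l) ki.1 *: s ki.2.

Lemma comb_nil (V : lmodType C) I (s : I -> V) : comb s [::] = 0.
Proof. exact: big_nil. Qed.

Lemma comb_cons (V : lmodType C) I (s : I -> V) ki l :
  comb s (ki :: l) = ki.1 *: s ki.2 + comb s l.
Proof. exact: big_cons. Qed.

Lemma comb1 (V : lmodType C) I (s : I -> V) i : comb s [:: (1, i)] = s i.
Proof. by rewrite comb_cons comb_nil scale1r addr0. Qed.

Lemma comb_lin (V : lmodType C) I (s : I -> V) k l l' :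
  comb s ([seq (k * ki.1, ki.2) | ki <- l] ++ l') = k *: comb s l + comb s l'.
Proof.
rewrite /comb big_cat big_map scaler_sumr; congr (_ + _).
by apply: eq_bigr => ki _; rewrite scalerA.
Qed.

Section LinearMaps.
Context {V W : lmodType C} {f : V -> W}.
Hypothesis flin : linear f.

Lemma lin_add x y : f (x + y) = f x + f y.
Proof. by have := flin 1 x y; rewrite !scale1r. Qed.

Lemma lin0 : f 0 = 0.
Proof. by apply: (@addrI _ (f 0)); rewrite -lin_add !addr0. Qed.

Lemma lin_scale k x : f (k *: x) = k *: f x.
Proof. by rewrite -[k *: x]addr0 flin lin0 addr0. Qed.

Lemma lin_sub x y : f (x - y) = f x - f y.
Proof. by rewrite -[- y]scaleN1r lin_add lin_scale scaleN1r. Qed.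

Lemma lin_sum (J : Type) (r : seq J) (k : J -> C) (v : J -> V) :
  f (\sum_(j <- r) k j *: v j) = \sum_(j <- r) k j *: f (v j).
Proof.
elim: r => [|j r IH]; first by rewrite !big_nil lin0.
by rewrite !big_cons flin IH.
Qed.

End LinearMaps.

Lemma linear_comb (V W : lmodType C) (f : V -> W) I (s : I -> V) l :
  linear f -> f (comb s l) = comb (f \o s) l.
Proof.
by move=> flin; rewrite /comb lin_sum.
Qed.

(** The tolerance [e] is an element of [R[i]]; the condition [0 < e] forces it to be real. *)
Definition closed_span (V : normedModType C) (I : Type) (s : I -> V) : set V :=
  [set x | forall e, 0 < e -> exists l, `|x - comb s l| < e].

Definition total_family (V : normedModType C) (I : Type) (s : I -> V) :=
  forall x, closed_span s x.

(** Bridge from the totality of a set, used in the definitions, to indexed families, on which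
    extension and density arguments work. *)
Lemma total_familyP (V : normedModType C) I (s : I -> V) (S : set V) :
  S = range s -> total_set S <-> total_family s.
Proof.
move=> ->; have span_comb v : lin_span (range s) v <-> exists l, v = comb s l.
  split=> [[n [k [w [hw ->]]]]|[l ->]].
    have /choice[i hi] : forall j, exists i, s i = w j.
      by move=> j; have [i _ <-] := hw j; exists i.
    exists [seq (k j, i j) | j <- enum 'I_n].
    by rewrite /comb big_map /= big_enum; apply: eq_bigr => j _; rewrite hi.
  case: l => [|ki0 l].
    exists 0%N, (fun=> 0), (fun=> 0); split=> [[]//|].
    by rewrite big_ord0 comb_nil.
  pose l' := ki0 :: l.
  exists (size l'), (fun j => (nth ki0 l' j).1), (fun j => s (nth ki0 l' j).2).
  split; first by move=> j; exists (nth ki0 l' j).2.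
  by rewrite /comb (big_nth ki0) big_mkord.
rewrite /total_set /total_family /closed_span /=; split=> [tot x e e0|H].
  have : closure (lin_span (range s)) x by rewrite tot.
  move=> /(_ (ball x e)) [|v [/span_comb[l ->]]]; first exact: nbhsx_ballx.
  by rewrite -ball_normE /= => h; exists l.
rewrite -subTset => x _ U /nbhs_ballP[e e0 hU].
have [l hl] := H x e e0; exists (comb s l); split; first by apply/span_comb; exists l.
by apply: hU; rewrite -ball_normE.
Qed.

Lemma approx_lin (V : normedModType C) (k : C) (a b a' b' : V) e :
  `|a - b| < e / 2 / (`|k| + 1) -> `|a' - b'| < e / 2 ->
  `|k *: a + a' - (k *: b + b')| < e.
Proof.
(* The weight is [|k| + 1] instead of [|k|], so that [k = 0] causes no division by zero. *)
move=> hab hab'; have k0 : 0 < `|k| + 1 by rewrite ltr_wpDl.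
rewrite opprD addrACA -scalerBr (splitr e).
apply: le_lt_trans (ler_normD _ _) _; apply: ler_ltD => //.
rewrite normrZ; apply: (@le_trans _ _ ((`|k| + 1) * `|a - b|)).
  by rewrite ler_wpM2r// lerDl.
by rewrite mulrC -ler_pdivlMr// ltW.
Qed.

Lemma approx_lin_gt0 (k : C) e : 0 < e -> 0 < e / 2 / (`|k| + 1) /\ 0 < e / 2.
Proof. by move=> e0; rewrite !divr_gt0// ltr_wpDl. Qed.

Definition bounded_linear (E F : normedModType C) (f : E -> F) :=
  linear f /\ exists2 c, 0 <= c & forall x, `|f x| <= c * `|x|.

Lemma small_norm0 (E : normedModType C) (x : E) c :
  0 <= c -> (forall e, 0 < e -> `|x| <= c * e) -> x = 0.
Proof.
move=> c0 H; apply/eqP; rewrite -normr_le0; apply/ler_addgt0Pr => e e0.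
rewrite add0r; have c1 : 0 < c + 1 by rewrite ltr_wpDl.
apply: (le_trans (H (e / (c + 1)) _)); first by rewrite divr_gt0.
by rewrite mulrCA ler_piMr ?ltW// ltr_pdivrMr// mul1r ltrDl.
Qed.

Lemma closed_span_mem (V : normedModType C) I (s : I -> V) i : closed_span s (s i).
Proof. by move=> e e0; exists [:: (1, i)]; rewrite comb1 subrr normr0. Qed.

Lemma closed_span_lin (V : normedModType C) I (s : I -> V) k x y :
  closed_span s x -> closed_span s y -> closed_span s (k *: x + y).
Proof.
move=> hx hy e e0; have [d0 d'0] := approx_lin_gt0 k e0.
have [l hl] := hx _ d0; have [l' hl'] := hy _ d'0.
exists ([seq (k * ki.1, ki.2) | ki <- l] ++ l'); rewrite comb_lin.
exact: approx_lin.
Qed.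

Lemma closed_span0 (V : normedModType C) I (s : I -> V) : closed_span s 0.
Proof. by move=> e e0; exists [::]; rewrite comb_nil subrr normr0. Qed.

Lemma closed_span_lim (V : normedModType C) I (s : I -> V) x :
  (forall e, 0 < e -> exists2 y, closed_span s y & `|x - y| < e) -> closed_span s x.
Proof.
move=> H e e0; have e20 : 0 < e / 2 by rewrite divr_gt0.
have [y hy xy] := H _ e20; have [l hl] := hy _ e20.
by exists l; rewrite -[x](subrK y) -addrA (splitr e) (le_lt_trans (ler_normD _ _))// ltrD.
Qed.

Lemma closed_span_map (V W : normedModType C) I J (s : I -> V) (t : J -> W) f x :
  bounded_linear f -> (forall i, closed_span t (f (s i))) ->
  closed_span s x -> closed_span t (f x).
Proof.
move=> [flin [c c0 fc]] fs hx; apply: closed_span_lim => e e0.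
have c1 : 0 < c + 1 by rewrite ltr_wpDl.
have [l hl] := hx _ (divr_gt0 e0 c1); exists (f (comb s l)).
  rewrite linear_comb//; elim: l {hl} => [|ki l IH].
    by rewrite comb_nil; exact: closed_span0.
  by rewrite comb_cons; apply: closed_span_lin => //; exact: fs.
rewrite -(lin_sub flin); apply: le_lt_trans (fc _) _.
apply: (@le_lt_trans _ _ (c * (e / (c + 1)))); first by rewrite ler_wpM2l// ltW.
by rewrite mulrCA gtr_pMr// ltr_pdivrMr// mul1r ltrDl.
Qed.

(** The density principle behind all later identities: for a combination [c] close to [x],
    [f x - g x = f (x - c) - g (x - c)], which is small. *)
Lemma bounded_linear_eq (E F : normedModType C) (f g : E -> F) I (s : I -> E) :
  bounded_linear f -> bounded_linear g -> total_family s ->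
  (forall i, f (s i) = g (s i)) -> f =1 g.
Proof.
move=> [flin [c c0 fc]] [glin [d d0 gd]] tot fg x.
apply/eqP; rewrite -subr_eq0; apply/eqP/(small_norm0 (addr_ge0 c0 d0)) => e e0.
have [l hl] := tot x e e0.
have -> : f x - g x = f (x - comb s l) - g (x - comb s l).
  have fgl : f (comb s l) = g (comb s l).
    by rewrite !linear_comb//; apply: eq_bigr => ki _ /=; rewrite fg.
  by rewrite (lin_sub flin) (lin_sub glin) fgl opprB addrA subrK.
apply: le_trans (ler_normB _ _) _; rewrite mulrDl lerD//.
  by apply: le_trans (fc _) _; rewrite ler_wpM2l// ltW.
by apply: le_trans (gd _) _; rewrite ler_wpM2l// ltW.
Qed.

(** The graph of the extension is the closure of the pairs [(comb s l, comb t l)]. The bound makes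
    it single-valued, even when different lists represent the same vector, and completeness of [F]
    makes it defined everywhere. *)
Lemma bounded_extension (E : normedModType C) (F : completeNormedModType C) I
    (s : I -> E) (t : I -> F) c :
  total_family s -> 0 <= c -> (forall l, `|comb t l| <= c * `|comb s l|) ->
  exists T : E -> F,
    [/\ linear T, forall x, `|T x| <= c * `|x| & forall i, T (s i) = t i].
Proof.
move=> tot c0 bnd.
pose ext x y := forall e, 0 < e ->
  exists l, `|x - comb s l| < e /\ `|y - comb t l| < e.
have ext_lin k x x' y y' : ext x y -> ext x' y' -> ext (k *: x + x') (k *: y + y').
  move=> h h' e e0; have [d0 d'0] := approx_lin_gt0 k e0.
  have [l [hl1 hl2]] := h _ d0; have [l' [hl'1 hl'2]] := h' _ d'0.
  exists ([seq (k * ki.1, ki.2) | ki <- l] ++ l'); rewrite !comb_lin.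
  by split; exact: approx_lin.
have ext_bnd x y : ext x y -> `|y| <= c * `|x|.
  move=> h; apply/ler_addgt0Pr => e e0.
  have c1 : 0 < c + 1 by rewrite ltr_wpDl.
  have [l [h1 h2]] := h (e / (c + 1)) (divr_gt0 e0 c1).
  rewrite -[y](subrK (comb t l)); apply: le_trans (ler_normD _ _) _.
  have hs : `|comb s l| <= e / (c + 1) + `|x|.
    rewrite -[comb s l](subrK x); apply: le_trans (ler_normD _ _) _.
    by rewrite lerD2r distrC ltW.
  have e_split : e = e / (c + 1) + c * (e / (c + 1)).
    by field; rewrite gt_eqF.
  rewrite [in leRHS]e_split addrCA lerD//; first exact: ltW.
  by apply: le_trans (bnd _) _; rewrite -mulrDr ler_wpM2l// addrC.
(* The value at [x] is the limit of the filter generated by the sets of [comb t l] with [comb s l]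
   within [e] of [x]. *)
have ext_ex x : exists y, ext x y.
  pose B e := [set comb t l | l in [set l | `|x - comb s l| < e]].
  pose Fx := filter_from [set e : C | 0 < e] B.
  have FF : Filter Fx.
    apply: filter_from_filter; first by exists 1; rewrite /= ltr01.
    move=> i j i0 j0; exists (Num.min i j).
      by rewrite /= comparable_lt_min ?i0 ?j0// real_comparable ?gtr0_real.
    move=> _ [l + <-]; rewrite /= comparable_lt_min ?real_comparable ?gtr0_real//.
    by move=> /andP[? ?]; split; exists l.
  have PF : ProperFilter Fx.
    apply: filter_from_proper => e e0.
    by have [l hl] := tot x e e0; exists (comb t l), l.
  have cF : cauchy Fx.
    apply: cauchy_exP => e e0.
    (* Two combinations within [d] of [x] differ by at most [2 d], so their images differ by at most
       [2 c d < e]. *)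
    have c2 : 0 < (c + 1) * 2 by rewrite mulr_gt0// ltr_wpDl.
    pose d := e / ((c + 1) * 2).
    have d0 : 0 < d by rewrite divr_gt0.
    have [l hl] := tot x d d0; exists (comb t l); exists d => //.
    move=> _ [l' hl' <-]; rewrite -ball_normE /=.
    have -> : comb t l - comb t l' = comb t ([seq (-1 * ki.1, ki.2) | ki <- l'] ++ l).
      by rewrite comb_lin scaleN1r addrC.
    apply: le_lt_trans (bnd _) _; rewrite comb_lin scaleN1r.
    have -> : - comb s l' + comb s l = (x - comb s l') - (x - comb s l).
      by rewrite opprB [RHS]addrC addrA subrK addrC.
    apply: (@le_lt_trans _ _ (c * (d + d))).
      by rewrite ler_wpM2l//; apply: le_trans (ler_normB _ _) _; rewrite lerD// ltW.
    have -> : e = (c + 1) * (d + d) by rewrite /d; field; rewrite gt_eqF// ltr_wpDl.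
    by rewrite ltr_pM2r ?addr_gt0// ltrDl.
  have Fy : Fx --> lim Fx by exact: cauchy_cvg.
  exists (lim Fx) => e e0.
  have /fcvgrPdist_lt/(_ e e0)[d /= d0 hd] := Fy.
  (* A single list has to approximate both [x] and the limit. *)
  have de0 : 0 < Num.min d e.
    by rewrite comparable_lt_min ?d0 ?e0// real_comparable ?gtr0_real.
  have [l hl] := tot x _ de0.
  have : `|x - comb s l| < d /\ `|x - comb s l| < e.
    by apply/andP; rewrite -comparable_lt_min// real_comparable ?gtr0_real.
  by move=> [hd' he']; exists l; split=> //; apply: (hd (comb t l)); exists l.
have [T hT] := choice ext_ex.
(* By linearity of [ext], the difference of two candidate values is a value at [0], and the bound
   makes it vanish. *)
have ext_fun x y : ext x y -> T x = y.
  move=> hy; have := ext_lin (-1) _ _ _ _ hy (hT x).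
  rewrite !scaleN1r addNr => /ext_bnd; rewrite normr0 mulr0 normr_le0 addrC subr_eq0.
  by move/eqP.
exists T; split=> [k x x'|x|i].
- by apply: ext_fun; apply: ext_lin.
- by apply: ext_bnd; apply: hT.
apply: ext_fun => e e0; exists [:: (1, i)].
by split; rewrite comb1 subrr normr0.
Qed.

End LinearCombinations.

(** * Bounds without positivity *)

Section CStarAlgebras.
Context {R : realType} {A : cstarAlgType R}.
Local Notation C := R[i].
Implicit Types a b c : A.

Lemma star_linear_conj (k : C) a b : star (k *: a + b) = Num.conj k *: star a + star b.
Proof. by rewrite starD starZ. Qed.

Lemma star0 : star (0 : A) = 0.
Proof. by rewrite -[0 in LHS](scale0r (0 : A)) starZ conjC0 scale0r. Qed.

Lemma starN a : star (- a) = - star a.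
Proof. by rewrite -scaleN1r starZ rmorphN1 scaleN1r. Qed.

Lemma starB a b : star (a - b) = star a - star b.
Proof. by rewrite starD starN. Qed.

Lemma star1 : star (cone : A) = cone.
Proof. by rewrite -[LHS]cmul1l -{1}[cone]starK -starM cmul1l starK. Qed.

Lemma cmul0l b : 0 ** b = 0 :> A.
Proof. by rewrite -[0 in LHS](scale0r (0 : A)) cmulZl scale0r. Qed.

Lemma cmul0r b : b ** 0 = 0 :> A.
Proof. by rewrite -[0 in LHS](scale0r (0 : A)) cmulZr scale0r. Qed.

Lemma cmulNl a b : (- a) ** b = - (a ** b).
Proof. by rewrite -scaleN1r cmulZl scaleN1r. Qed.

Lemma cmulNr a b : a ** (- b) = - (a ** b).
Proof. by rewrite -scaleN1r cmulZr scaleN1r. Qed.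

Lemma cmulBl a b c : (a - b) ** c = a ** c - b ** c.
Proof. by rewrite cmulDl cmulNl. Qed.

Lemma cmulBr a b c : a ** (b - c) = a ** b - a ** c.
Proof. by rewrite cmulDr cmulNr. Qed.

Lemma norm_star a : `|star a| = `|a|.
Proof.
have le b : `|b| <= `|star b|.
  have [->|b0] := eqVneq b 0; first by rewrite normr0.
  have bpos : 0 < `|b| by rewrite normr_gt0.
  by rewrite -(ler_pM2r bpos) -expr2 -cnorm_star cnormM.
by apply/eqP; rewrite eq_le -{2}[a]starK !le.
Qed.

(** Only an inequality, because the algebra may be zero. *)
Lemma norm_cone_le1 : `|cone : A| <= 1.
Proof.
have [->|n0] := eqVneq (cone : A) 0; first by rewrite normr0.
have pos : 0 < `|cone : A| by rewrite normr_gt0.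
by rewrite -(ler_pM2r pos) mul1r -expr2 -cnorm_star star1 cmul1l.
Qed.

Lemma cmul_sqrB a b : a ** a - b ** b = a ** (a - b) + (a - b) ** b.
Proof. by rewrite cmulBr cmulBl addrA subrK. Qed.

(* The fixed points y of y |-> (h + y y) / 2 satisfy (1 - y)^2 = 1 - h, and the
   map is a contraction of the ball of radius 1/2. *)
Lemma sqrt_near_one h c : star h = h -> `|h| <= 1 / 2 -> c ** h = h ** c ->
  exists s : A, [/\ star s = s, s ** s = cone - h & c ** s = s ** c].
Proof.
move=> hs hn hc; have half0 : 0 <= 1 / 2 :> C by rewrite divr_ge0.
pose phi (y : A) : A := (1 / 2 : C) *: (h + y ** y).
have norm_phiB y z : `|phi y - phi z| <= 1 / 2 * ((`|y| + `|z|) * `|y - z|).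
  rewrite /phi -scalerBr normrZ ger0_norm// ler_wpM2l//.
  rewrite opprD addrACA subrr add0r cmul_sqrB.
  apply: le_trans (ler_normD _ _) _; rewrite mulrDl lerD ?cnormM//.
  by rewrite mulrC cnormM.
pose y n := iter n phi 0.
have yn n : `|y n| <= 1 / 2.
  elim: n => [|n IH]; first by rewrite normr0.
  rewrite /= /phi normrZ ger0_norm// -[leRHS]mulr1 ler_wpM2l//.
  apply: le_trans (ler_normD _ _) _.
  have -> : 1 = 1 / 2 + 1 / 2 :> C by field.
  rewrite lerD//; apply: le_trans (cnormM _ _) _.
  apply: (@le_trans _ _ (1 / 2 * 1)); last by rewrite mulr1.
  rewrite ler_pM//; apply: le_trans IH _.
  by rewrite ler_pdivrMr// mul1r ler1n.
(* On the ball of radius 1/2 the factor [|y| + |z|] in [norm_phiB] is at most 1, so each application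
   of [phi] halves distances. *)
have yS n : `|y n.+1 - y n| <= (1 / 2) ^+ n.+1.
  elim: n => [|n IH].
    by rewrite expr1 -[y 0%N]/(0 : A) subr0 yn.
  apply: le_trans (norm_phiB _ _) _; rewrite exprS ler_wpM2l//.
  apply: (@le_trans _ _ (1 * `|y n.+1 - y n|)); last by rewrite mul1r.
  rewrite ler_wpM2r//; have -> : 1 = 1 / 2 + 1 / 2 :> C by field.
  exact: lerD (yn n.+1) (yn n).
have ymn n m : `|y (n + m)%N - y n| <= (1 / 2) ^+ n - (1 / 2) ^+ (n + m).
  elim: m => [|m IH]; first by rewrite addn0 !subrr normr0.
  rewrite addnS -[y _.+1](subrK (y (n + m)%N)) -addrA.
  apply: le_trans (ler_normD _ _) _; apply: le_trans (lerD (yS _) IH) _.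
  rewrite le_eqVlt; apply/orP; left; apply/eqP; rewrite exprS; by field.
have small (e : C) : 0 < e -> exists n, (1 / 2) ^+ n < e.
  move=> e0; have eR : e = (complex.Re e)%:C%C.
    by rewrite RRe_real// gtr0_real.
  have Re0 : 0 < complex.Re e by move: e0; rewrite eR ltcR.
  have [N _ hN] := near_infty_natSinv_expn_lt (PosNum Re0).
  have hn' := hN N (leqnn N).
  exists N; rewrite eR; move: hn'; rewrite -ltcR /= => /le_lt_trans; apply.
  by rewrite expr_div_n expr1n rmorphM rmorph1 fmorphV rmorphXn rmorph_nat.
have ycauchy : cauchy (y n @[n --> \oo]).
  apply: cauchy_exP => e e0; have [n hn'] := small e e0.
  exists (y n); exists n => // m /= nm; rewrite -ball_normE /= distrC -(subnKC nm).
  apply: le_lt_trans (ymn _ _) _; apply: le_lt_trans hn'.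
  by rewrite gerBl exprn_ge0.
have ycvg : y n @[n --> \oo] --> lim (y n @[n --> \oo]) by exact: cauchy_cvg.
set l := lim _ in ycvg.
(* Two consecutive iterates are controlled together, since [phi l] is compared with [l] through
   [phi (y n) = y n.+1]. *)
have near_l e : 0 < e -> exists n, `|l - y n| < e /\ `|l - y n.+1| < e.
  move=> e0; have /cvgrPdist_lt/(_ e e0)[n _ hn'] := ycvg.
  by exists n; split; apply: hn' => /=.
have lphi : phi l = l.
  apply/eqP; rewrite -subr_eq0; apply/eqP.
  apply: (@small_norm0 _ _ _ (1 / 2 * (`|l| + 1 / 2) + 1)) => [|e e0].
    by rewrite addr_ge0// mulr_ge0// addr_ge0.
  have [n [h1 h2]] := near_l e e0.
  rewrite -[phi l](subrK (phi (y n))) -addrA.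
  apply: le_trans (ler_normD _ _) _; rewrite mulrDl [1 * e]mul1r; apply: lerD; last first.
    rewrite distrC. exact: ltW.
  apply: le_trans (norm_phiB _ _) _; rewrite -[leRHS]mulrA ler_wpM2l//.
  by apply: ler_pM => //; [rewrite lerD2l yn|exact: ltW].
have lstar : star l = l.
  have ystar n : star (y n) = y n.
    elim: n => [|n IH]; first exact: star0.
    by rewrite /= /phi starZ starD hs starM IH rmorphM rmorph1 fmorphV rmorph_nat.
  apply/eqP; rewrite -subr_eq0; apply/eqP/(@small_norm0 _ _ _ 2) => // e e0.
  have [n [h1 _]] := near_l e e0.
  have -> : star l - l = star (l - y n) - (l - y n).
    by rewrite starB ystar opprB addrA subrK.
  apply: le_trans (ler_normB _ _) _.
  by rewrite norm_star -mulr2n mulr_natl lerMn2r ltW.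
have lc : c ** l = l ** c.
  have yc n : c ** y n = y n ** c.
    elim: n => [|n IH]; first by rewrite cmul0l cmul0r.
    by rewrite /= /phi cmulZl cmulZr cmulDl cmulDr hc cmulA IH -cmulA IH cmulA.
  apply/eqP; rewrite -subr_eq0; apply/eqP.
  apply: (@small_norm0 _ _ _ (`|c| + `|c|)) => [|e e0]; first exact: addr_ge0.
  have [n [h1 _]] := near_l e e0.
  have -> : c ** l - l ** c = c ** (l - y n) - (l - y n) ** c.
    by rewrite cmulBr cmulBl yc opprB addrA subrK.
  apply: le_trans (ler_normB _ _) _; rewrite mulrDl lerD//.
    by apply: le_trans (cnormM _ _) _; rewrite ler_wpM2l// ltW.
  by apply: le_trans (cnormM _ _) _; rewrite mulrC ler_wpM2l// ltW.
exists (cone - l); split; first by rewrite starB star1 lstar.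
  (* Doubling the fixed point equation gives [h = l + l - l ** l], hence the square of [cone - l] is
     [cone - h]. *)
  have := congr1 (fun v => (2 : C) *: v) lphi.
  rewrite /phi scalerA mulrC divfK ?pnatr_eq0// scale1r scaler_nat mulr2n.
  rewrite cmulBl cmul1l cmulBr cmul1r => /(canRL (addrK _)) ->.
  by rewrite -(addrA cone) -opprD addrA.
by rewrite cmulBl cmulBr cmul1l cmul1r lc.
Qed.

Lemma half_double (V : lmodType C) (v : V) : (1 / 2 : C) *: (v + v) = v.
Proof.
by rewrite scalerDr -scalerDl -mulrDl -mulr2n divff ?scale1r// pnatr_eq0.
Qed.

(** Take [v = h + 'i *: s] with [s] a self-adjoint square root of [cone - h ** h] commuting with
    [h]; then [star v = h - 'i *: s], and both products equal [h ** h + s ** s = cone]. *)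
Lemma self_adjoint_unitary h : star h = h -> `|h| <= 1 / 2 ->
  exists v : A, [/\ star v ** v = cone, v ** star v = cone &
                    h = (1 / 2 : C) *: (v + star v)].
Proof.
move=> hs hn; have half0 : 0 <= 1 / 2 :> C by rewrite divr_ge0.
have [||| s [ss s2 hsc]] := @sqrt_near_one (h ** h) h.
- by rewrite starM hs.
- apply: le_trans (cnormM _ _) _; apply: (@le_trans _ _ (1 / 2 * 1)); last by rewrite mulr1.
  rewrite ler_pM//; apply: le_trans hn _.
  by rewrite ler_pdivrMr// mul1r ler1n.
- by rewrite cmulA.
have vs : star (h + 'i *: s) = h - 'i *: s.
  by rewrite starD starZ hs ss conjCi scaleNr.
have prod1 t : t ** t = cone - h ** h -> h ** t = t ** h ->
    (h - 'i *: t) ** (h + 'i *: t) = cone.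
  move=> t2 ht; rewrite cmulBl !cmulDr !cmulZl !cmulZr scalerA -expr2 sqrCi ht t2.
  by rewrite scaleN1r opprD opprK addrA addrK addrC subrK.
exists (h + 'i *: s); rewrite vs; split; first exact: prod1.
  (* The product in the other order is the same identity with [- s] in place of [s]. *)
  have := prod1 (- s); rewrite scalerN opprK !cmulNl !cmulNr opprK hsc.
  by move=> /(_ s2 erefl).
by rewrite addrACA subrr addr0 half_double.
Qed.

(** An element of norm at most 1/2 is [h + 'i *: k] with [h], [k] self-adjoint of norm at most 1/2,
    each an average of two unitaries. So [f] is bounded there by [2 M], and rescaling to norm 1/2
    gives the factor 4. *)
Lemma bounded_on_unitaries (W : normedModType C) (f : A -> W) M : linear f ->
  (forall v, star v ** v = cone -> v ** star v = cone -> `|f v| <= M) ->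
  forall a, `|f a| <= 4 * M * `|a|.
Proof.
move=> flin hf; have half0 : 0 <= 1 / 2 :> C by rewrite divr_ge0.
have fD := lin_add flin; have f0 := lin0 flin; have fZ := lin_scale flin.
have hsa h : star h = h -> `|h| <= 1 / 2 -> `|f h| <= M.
  move=> hs hn; have [v [v1 v2 ->]] := self_adjoint_unitary hs hn.
  rewrite fZ fD normrZ ger0_norm// mul1r ler_pdivrMl// mulr_natl.
  apply: le_trans (ler_normD _ _) _; rewrite mulr2n lerD// hf// starK//.
have half a : `|a| <= 1 / 2 -> `|f a| <= M + M.
  move=> an.
  pose h := (1 / 2 : C) *: (a + star a).
  pose k := (- 'i / 2 : C) *: (a - star a).
  have -> : a = h + 'i *: k.
    rewrite /h /k scalerA mulrA mulrN -expr2 sqrCi opprK -scalerDr addrACA subrr addr0.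
    by rewrite half_double.
  have hs : star h = h by rewrite /h starZ starD starK rmorphM fmorphV rmorph1 rmorph_nat addrC.
  have ks : star k = k.
    rewrite /k starZ starB starK rmorphM fmorphV rmorph_nat rmorphN /= conjCi opprK.
    by rewrite -opprB scalerN -scaleNr mulNr.
  have hn : `|h| <= 1 / 2.
    rewrite /h normrZ ger0_norm// -[leRHS]mulr1 ler_wpM2l//.
    apply: le_trans (ler_normD _ _) _; rewrite norm_star.
    have -> : 1 = 1 / 2 + 1 / 2 :> C by field.
    by rewrite lerD.
  have kn : `|k| <= 1 / 2.
    rewrite /k normrZ normrM normrN normCi normfV gtr0_norm// -[leRHS]mulr1 ler_wpM2l//.
    apply: le_trans (ler_normB _ _) _; rewrite norm_star.
    have -> : 1 = 1 / 2 + 1 / 2 :> C by field.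
    by rewrite lerD.
  rewrite fD (fZ 'i k); apply: le_trans (ler_normD _ _) _.
  by rewrite normrZ normCi mul1r lerD// hsa.
move=> a; have [->|a0] := eqVneq a 0; first by rewrite f0 !normr0 mulr0.
have apos : 0 < `|a| by rewrite normr_gt0.
have kpos : 0 < (2 * `|a|)^-1 by rewrite invr_gt0 mulr_gt0.
have na : `|(2 * `|a|)^-1 *: a| = 1 / 2.
  by rewrite normrZ gtr0_norm//; field; rewrite gt_eqF.
have := half ((2 * `|a|)^-1 *: a).
rewrite na => /(_ (lexx _)); rewrite (fZ _ a) normrZ gtr0_norm//.
rewrite ler_pdivrMl ?mulr_gt0// => /le_trans; apply.
by rewrite le_eqVlt; apply/orP; left; apply/eqP; ring.
Qed.

End CStarAlgebras.

(** * Norm estimates for inner products and for the two module actions *)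

Section HilbertModules.
Context {R : realType} {A : cstarAlgType R}.
Local Notation C := R[i].

Section InnerProduct.
Context {E : hilbModType A}.
Implicit Types x y : E.

Lemma dot_linear x : linear (dot x : E -> A).
Proof. by move=> k y z; rewrite dotDr dotZr. Qed.

Lemma dotDl x y z : dot (x + y) z = dot x z + dot y z :> A.
Proof. by rewrite -dot_star dotDr starD !dot_star. Qed.

Lemma dotZl k x y : dot (k *: x) y = Num.conj k *: dot x y :> A.
Proof. by rewrite -dot_star dotZr starZ dot_star. Qed.

Lemma dotBl x y z : dot (x - y) z = dot x z - dot y z :> A.
Proof. by rewrite -scaleN1r dotDl dotZl rmorphN1 scaleN1r. Qed.

Lemma dotBr x y z : dot x (y - z) = dot x y - dot x z :> A.
Proof. by rewrite -scaleN1r dotDr dotZr scaleN1r. Qed.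

Lemma dot0r x : dot x 0 = 0 :> A.
Proof. by rewrite -(subrr x) dotBr subrr. Qed.

Lemma dot0l x : dot 0 x = 0 :> A.
Proof. by rewrite -dot_star dot0r star0. Qed.

Lemma dot_comb I (s : I -> E) l x :
  dot x (comb s l) = comb (fun i => dot x (s i) : A) l.
Proof. exact: (linear_comb _ _ (dot_linear x)). Qed.

Lemma dot_combl I (s : I -> E) l x :
  dot (comb s l) x = \sum_(ki <- l) Num.conj ki.1 *: (dot (s ki.2) x : A).
Proof.
elim: l => [|ki l IH].
  by rewrite comb_nil big_nil dot0l.
by rewrite comb_cons big_cons dotDl dotZl IH.
Qed.

Lemma dot_ractl x y (a : A) : dot (ract x a) y = star a ** dot x y :> A.
Proof. by rewrite -dot_star dot_ract starM dot_star. Qed.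

Lemma dot_inj x y : (forall z, dot z x = dot z y :> A) -> x = y.
Proof.
move=> H; apply/eqP; rewrite -subr_eq0 -normr_eq0 -sqrf_eq0 (dot_norm (A := A)).
by rewrite dotBr H subrr normr0.
Qed.

(* Polarisation, together with the triangle inequality, replaces the
   Cauchy-Schwarz inequality at the cost of a constant. *)
Lemma norm_dot x y : `|dot x y : A| <= 4 * `|x| * `|y|.
Proof.
have sym (u v : E) : `|u| <= 1 -> `|v| <= 1 -> `|dot u v + dot v u : A| <= 4.
  move=> hu hv.
  have sq (w : E) : `|w| <= 2 -> `|dot w w : A| <= 4.
    move=> hw; rewrite -dot_norm; have -> : 4 = 2 ^+ 2 :> C by rewrite -natrX.
    by rewrite ler_pXn2r ?nnegrE.
  (* Since [u + v] and [u - v] have norm at most 2, the two squares have norm at most 4; their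
     difference is twice the symmetrised product. *)
  have two : `|dot (u + v) (u + v) - dot (u - v) (u - v) : A| <= 4 + 4.
    apply: le_trans (ler_normB _ _) _; rewrite lerD// sq//.
      by apply: le_trans (ler_normD _ _) _; exact: lerD.
    by apply: le_trans (ler_normB _ _) _; exact: lerD.
  have e : dot (u + v) (u + v) - dot (u - v) (u - v) =
           (2 : C) *: (dot u v + dot v u) :> A.
    rewrite scaler_nat mulr2n dotDl dotBl !dotBr !dotDr !opprB.
    set a := dot u u; set b := dot v v; set c := dot u v; set d := dot v u.
    have pq (p q : A) : p + q + (q - p) = q + q by rewrite addrC addrA subrK.
    by rewrite [_ + (c - a)]addrC addrACA pq [d + b]addrC pq addrACA.
  move: two; rewrite e normrZ normr_nat -natrD -[(4 + 4)%N]/(2 * 4)%N natrM.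
  by rewrite ler_pM2l.
have unit (u v : E) : `|u| <= 1 -> `|v| <= 1 -> `|dot u v : A| <= 4.
  move=> hu hv.
  (* Applying the symmetric bound to [v] and to ['i *: v] and combining cancels [dot v u]. *)
  have e : (2 : C) *: dot u v =
      (dot u v + dot v u) - 'i *: (dot u ('i *: v) + dot ('i *: v) u) :> A.
    rewrite dotZr dotZl conjCi scalerDr !scalerA -expr2 mulrN -expr2 sqrCi opprK.
    by rewrite scaleN1r scale1r opprD opprK addrACA subrr addr0 scaler_nat mulr2n.
  have : `|(2 : C) *: dot u v : A| <= 4 + 4.
    rewrite e; apply: le_trans (ler_normB _ _) _; rewrite normrZ normCi mul1r.
    by rewrite lerD// sym// normrZ normCi mul1r.
  rewrite normrZ normr_nat -natrD -[(4 + 4)%N]/(2 * 4)%N natrM.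
  by rewrite ler_pM2l.
have [->|x0] := eqVneq x 0.
  by rewrite dot0l !normr0 mulr0 mul0r.
have [->|y0] := eqVneq y 0.
  by rewrite dot0r !normr0 mulr0.
have hx : 0 < `|x| by rewrite normr_gt0.
have hy : 0 < `|y| by rewrite normr_gt0.
have normed (z : E) : 0 < `|z| -> `| `|z|^-1 *: z| <= 1.
  by move=> hz; rewrite normrZ normfV normr_id mulVf ?gt_eqF.
have := unit _ _ (normed x hx) (normed y hy).
rewrite dotZl dotZr !normrZ norm_conjC !normfV !normr_id.
by rewrite ler_pdivrMl// ler_pdivrMl// mulrC [_ * 4]mulrC.
Qed.

Lemma norm_ract x (a : A) : `|ract x a| <= `|x| * `|a|.
Proof.
rewrite -(@ler_pXn2r _ 2)// ?nnegrE ?mulr_ge0// (dot_norm (A := A)) dot_ract dot_ractl.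
rewrite exprMn (dot_norm (A := A)) expr2 mulrA.
apply: le_trans (cnormM _ _) _; rewrite ler_wpM2r//.
by apply: le_trans (cnormM _ _) _; rewrite mulrC norm_star.
Qed.

Lemma bounded_dot x : bounded_linear (dot x : E -> A).
Proof.
split; first exact: dot_linear.
by exists (4 * `|x|) => [|y]; [exact: mulr_ge0|exact: norm_dot].
Qed.

Lemma bounded_ractl x : bounded_linear (ract x : A -> E).
Proof.
split; first by move=> k a b; rewrite ractDr ractZr.
by exists `|x| => // a; exact: norm_ract.
Qed.

Lemma bounded_ractr (a : A) : bounded_linear (fun x : E => ract x a).
Proof.
split; first by move=> k x y; rewrite ractDl ractZl.
by exists `|a| => // x; rewrite mulrC; exact: norm_ract.
Qed.

(** Identities in a Hilbert module can be tested against a total family. The adjoint is taken first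
    because [dot] is linear only in its second variable. *)
Lemma dot_total I (s : I -> E) x y : total_family s ->
  (forall i, dot (s i) x = dot (s i) y :> A) -> x = y.
Proof.
move=> tot H; apply: dot_inj => z; rewrite -[LHS]dot_star -[RHS]dot_star; congr star.
apply: bounded_linear_eq z; [exact: bounded_dot|exact: bounded_dot|exact: tot|].
by move=> i /=; rewrite -[LHS]dot_star -[RHS]dot_star H.
Qed.

End InnerProduct.

Lemma bounded_linear_comp (E F H : normedModType C) (f : F -> H) (g : E -> F) :
  bounded_linear f -> bounded_linear g -> bounded_linear (f \o g).
Proof.
move=> [flin [c c0 fc]] [glin [d d0 gd]]; split.
  by move=> k x y /=; rewrite glin flin.
exists (c * d) => [|x]; first exact: mulr_ge0.
by apply: le_trans (fc _) _; rewrite -mulrA ler_wpM2l.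
Qed.

Lemma bounded_id (E : normedModType C) : bounded_linear (@id E).
Proof. by split=> //; exists 1 => // x; rewrite mul1r. Qed.

Section LeftAction.
Context {E : corrType A}.
Implicit Types (x y : E) (a : A).

(** Additivity in the module variable comes from adjointability, by moving [a] to the other side of
    the inner product. *)
Lemma lactDr a x y : lact a (x + y) = lact a x + lact a y.
Proof.
by apply: dot_inj => z; rewrite -[a]starK -lact_adj !dotDr -!lact_adj.
Qed.

Lemma lactZr a (k : C) x : lact a (k *: x) = k *: lact a x.
Proof.
by apply: dot_inj => z; rewrite -[a]starK -lact_adj !dotZr -lact_adj.
Qed.

Lemma lact_ract a x (b : A) : lact a (ract x b) = ract (lact a x) b.
Proof.
by apply: dot_inj => z; rewrite -[a]starK -lact_adj !dot_ract -lact_adj.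
Qed.

(** A unitary [v] satisfies [|v x| = |1 x|], as both squares are the norm of [dot x (lact cone x)].
    The operator [lact cone] is only known to be a projection; [norm_dot] bounds it by 4, and
    passing from unitaries to all elements costs another factor 4. *)
Lemma norm_lact a x : `|lact a x| <= 16 * `|a| * `|x|.
Proof.
have lin : linear (fun b : A => lact b x) by move=> k b c; rewrite lactDl lactZl.
have norm_unitary v : star v ** v = cone -> `|lact v x| = `|lact cone x|.
  move=> hv; apply/eqP; rewrite -(@eqrXn2 _ 2)// !(dot_norm (A := A)) !lact_adj.
  by rewrite -!lactM hv star1 cmul1l.
have hcone : `|lact cone x| <= 4 * `|x|.
  have [->|n0] := eqVneq (lact cone x) 0; first by rewrite normr0 mulr_ge0.
  have pos : 0 < `|lact cone x| by rewrite normr_gt0.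
  rewrite -(ler_pM2r pos) -expr2 (dot_norm (A := A)) lact_adj -lactM star1 cmul1l.
  exact: norm_dot.
have := bounded_on_unitaries lin (M := 4 * `|x|) _ a.
have -> : 4 * (4 * `|x|) * `|a| = 16 * `|a| * `|x|.
  by rewrite [4 * (4 * _)]mulrA -natrM mulrAC.
by apply=> v hv _; rewrite norm_unitary.
Qed.

Lemma bounded_lactl x : bounded_linear (fun a => lact a x).
Proof.
split; first by move=> k a b; rewrite lactDl lactZl.
by exists (16 * `|x|) => [|a]; rewrite ?mulr_ge0// mulrAC norm_lact.
Qed.

Lemma bounded_lactr a : bounded_linear (lact a : E -> E).
Proof.
split; first by move=> k x y; rewrite lactDr lactZr.
by exists (16 * `|a|) => [|x]; rewrite ?mulr_ge0// norm_lact.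
Qed.

End LeftAction.
End HilbertModules.

(** By the C*-identity a unital star-homomorphism sends unitaries to elements of norm at most 1. *)
Lemma norm_star_hom (R : realType) (B D : cstarAlgType R) (f : B -> D) a :
  star_hom f -> `|f a| <= 4 * `|a|.
Proof.
move=> [flin fM f1 fs]; rewrite -[4]mulr1; apply: bounded_on_unitaries => // v hv _.
rewrite -(@expr_le1 _ 2)// -cnorm_star -fs -fM hv f1; exact: norm_cone_le1.
Qed.

(** * Interior tensor products *)

Section Unitaries.
Context {R : realType} {A : cstarAlgType R}.
Local Notation C := R[i].

Section UnitaryMaps.
Context {E F : hilbModType A} {U : E -> F}.
Hypothesis hU : unitary U.

Lemma unitary_dot x y : dot (U x) (U y) = dot x y :> A.
Proof. by have [V [adj UK VK]] := hU; rewrite adj UK. Qed.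

(** Linearity is not part of [unitary]; it follows from the existence of an adjoint. *)
Lemma unitary_linear : linear U.
Proof.
have [V [adj UK VK]] := hU => k x y; apply: dot_inj => z.
have adj' w : dot z (U w) = dot (V z) w :> A by rewrite -dot_star adj dot_star.
by rewrite dotDr dotZr !adj' dotDr dotZr.
Qed.

Lemma unitary_ract x (a : A) : U (ract x a) = ract (U x) a.
Proof.
have [V [adj UK VK]] := hU; apply: dot_inj => z.
have adj' w : dot z (U w) = dot (V z) w :> A by rewrite -dot_star adj dot_star.
by rewrite dot_ract !adj' dot_ract.
Qed.

Lemma unitary_norm x : `|U x| = `|x|.
Proof. by apply/eqP; rewrite -(@eqrXn2 _ 2)// !(dot_norm (A := A)) unitary_dot. Qed.

Lemma bounded_unitary : bounded_linear U.
Proof.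
by split; [exact: unitary_linear|exists 1 => // x; rewrite mul1r unitary_norm].
Qed.

Lemma unitary_total I (s : I -> E) : total_family s -> total_family (U \o s).
Proof.
have [V [adj UK VK]] := hU => tot x e e0; have [l hl] := tot (V x) e e0.
exists l; rewrite -(linear_comb _ _ unitary_linear) -[x]VK.
by rewrite -(lin_sub unitary_linear) unitary_norm.
Qed.

End UnitaryMaps.

(** Equal inner products give corresponding combinations equal norms, so [s i |-> t i] and its
    inverse both extend with constant 1; the extensions are mutually inverse and adjoint by
    density. *)
Lemma unitary_extension (E F : hilbModType A) I (s : I -> E) (t : I -> F) :
  total_family s -> total_family t ->
  (forall i j, dot (s i) (s j) = dot (t i) (t j) :> A) ->
  exists U : E -> F, unitary U /\ forall i, U (s i) = t i.
Proof.
move=> tots tott st.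
have norm_st l : `|comb s l| = `|comb t l|.
  apply/eqP; rewrite -(@eqrXn2 _ 2)// !(dot_norm (A := A)) !dot_combl.
  apply/eqP; congr `|_|; apply: eq_bigr => ki _; congr (_ *: _); rewrite !dot_comb.
  by apply: eq_bigr => kj _; rewrite st.
have [|U [Ulin Unorm Us]] := @bounded_extension _ _ _ _ s t 1 tots ler01.
  by move=> l; rewrite norm_st mul1r.
have [|V [Vlin Vnorm Vt]] := @bounded_extension _ _ _ _ t s 1 tott ler01.
  by move=> l; rewrite norm_st mul1r.
have bU : bounded_linear U by split=> //; exists 1.
have bV : bounded_linear V by split=> //; exists 1.
exists U; split=> //; exists V; split.
(* Adjointness needs one density argument per variable: first the second variable against [s i],
   then, after taking adjoints, the first. *)
- have adj i : dot (s i) \o V =1 (dot (t i) : F -> A).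
    apply: bounded_linear_eq tott _; [|exact: bounded_dot|].
      exact: (bounded_linear_comp (bounded_dot _) bV).
    by move=> j /=; rewrite Vt st.
  move=> x y; rewrite -[LHS]dot_star -[RHS]dot_star; congr star; move: x.
  change (dot y \o U =1 (dot (V y) : E -> A)).
  apply: bounded_linear_eq tots _; [|exact: bounded_dot|].
    exact: (bounded_linear_comp (bounded_dot _) bU).
  move=> i /=; rewrite Us -[RHS]dot_star.
  by have /= -> := adj i y; rewrite dot_star.
- apply: bounded_linear_eq; [exact: bounded_linear_comp bV bU|exact: bounded_id|exact: tots|].
  by move=> i /=; rewrite Us Vt.
- apply: bounded_linear_eq; [exact: bounded_linear_comp bU bV|exact: bounded_id|exact: tott|].
  by move=> i /=; rewrite Vt Us.
Qed.

Lemma uncurry_range (I J : Type) (W : Type) (t : I -> J -> W) :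
  [set w | exists i j, w = t i j] = range (fun ij => t ij.1 ij.2).
Proof.
apply/seteqP; split=> [_ [i [j ->]]|_ [[i j] _ <-]]; first by exists (i, j).
by exists i, j.
Qed.

Section InteriorTensor.
Context {E F : corrType A}.

Lemma interior_tensor_total (T : hilbModType A) (t : E -> F -> T) :
  interior_tensor t -> total_family (fun xy => t xy.1 xy.2).
Proof. by move/tensor_total => /(total_familyP (uncurry_range t)). Qed.

Lemma interior_tensor_unitary (T D : hilbModType A) (t : E -> F -> T) (U : T -> D) :
  interior_tensor t -> unitary U -> interior_tensor (fun x y => U (t x y)).
Proof.
move=> ht hU; have Ulin := unitary_linear hU; split.
- by move=> y k x x'; rewrite (tensor_linl ht) Ulin.
- by move=> x k y y'; rewrite (tensor_linr ht) Ulin.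
- by move=> x a y; rewrite (tensor_balanced ht).
- by move=> x y a; rewrite (tensor_ract ht) unitary_ract.
- by move=> x y x' y'; rewrite unitary_dot// (tensor_dot ht).
- apply/(total_familyP (uncurry_range _)).
  exact: (unitary_total hU (interior_tensor_total ht)).
Qed.

(** Forwards, the model [T] is carried to [D] by the unitary. Backwards, two models have the same
    inner products on elementary tensors, so [unitary_extension] compares them. *)
Lemma extends_to_unitaryP (D : corrType A) (m : E -> F -> D) :
  extends_to_unitary m <-> interior_tensor m.
Proof.
split=> [[[T [t ht]] /(_ T t ht)[U [hU Um]]]|hm].
  have -> : m = fun x y => U (t x y) by apply/funext=> x; apply/funext=> y; rewrite Um.
  exact: interior_tensor_unitary.
split=> [|T t ht]; first by exists D, m.
have [|U [hU Ut]] := unitary_extension (interior_tensor_total ht) (interior_tensor_total hm).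
  by move=> xy xy'; rewrite (tensor_dot ht) (tensor_dot hm).
by exists U; split=> // x y; rewrite (Ut (x, y)).
Qed.

End InteriorTensor.
End Unitaries.

(** * Bounds for interior tensor products, and their construction from total families *)

Section TensorExtension.
Context {R : realType} {A : cstarAlgType R}.
Local Notation C := R[i].

Section Bounds.
Context {E F : corrType A} {T : hilbModType A} {t : E -> F -> T}.
Hypothesis ht : interior_tensor t.

(** The constant 8 is the square root of [4 * 16], from [norm_dot] and [norm_lact]. *)
Lemma norm_lact_dot (x : E) (y : F) :
  `|dot y (lact (dot x x : A) y) : A| <= (8 * `|x| * `|y|) ^+ 2.
Proof.
apply: le_trans (norm_dot _ _) _.
have -> : (8 * `|x| * `|y|) ^+ 2 = 4 * `|y| * (16 * `|x| ^+ 2 * `|y|) by ring.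
by rewrite (dot_norm (A := A) x) ler_wpM2l ?mulr_ge0// norm_lact.
Qed.

Lemma norm_tensor x y : `|t x y| <= 8 * `|x| * `|y|.
Proof.
rewrite -(@ler_pXn2r _ 2)// ?nnegrE ?mulr_ge0//.
by rewrite (dot_norm (A := A)) (tensor_dot ht) norm_lact_dot.
Qed.

Lemma bounded_tensorl y : bounded_linear (t ^~ y).
Proof.
split; first exact: tensor_linl ht y.
by exists (8 * `|y|) => [|x]; rewrite ?mulr_ge0// mulrAC norm_tensor.
Qed.

Lemma bounded_tensorr x : bounded_linear (t x).
Proof.
split; first exact: tensor_linr ht x.
by exists (8 * `|x|) => [|y]; rewrite ?mulr_ge0// norm_tensor.
Qed.

Lemma interior_tensor_continuous : continuous_bilinear t.
Proof.
split; [exact: tensor_linr ht|exact: tensor_linl ht|move=> [x y] /=].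
(* The radius [d] is chosen so that [e] splits into the bounds for [t (x - w.1) y] and
   [t w.1 (y - w.2)] plus a strict slack [8 * d]; the cap 1 on the radius gives
   [|w.1| <= |x| + 1]. *)
have K0 : 0 < 8 * (`|x| + 1 + `|y| + 1) by rewrite mulr_gt0// !addr_gt0// ltr_wpDl.
apply/cvgrPdist_lt => e e0.
have d0 : 0 < e / (8 * (`|x| + 1 + `|y| + 1)) by rewrite divr_gt0.
set d := e / _ in d0.
have cmp : 1 >=< d by rewrite real_comparable ?gtr0_real.
apply/(nbhs_ballP (_, _)).  exists (Num.min 1 d) => [|w []] /=.
  by rewrite comparable_lt_min ?ltr01.
rewrite -!ball_normE /= !comparable_lt_min// => /andP[hx1 hx] /andP[_ hy].
have -> : t x y - t w.1 w.2 = t (x - w.1) y + t w.1 (y - w.2).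
  by rewrite (lin_sub (tensor_linl ht _)) (lin_sub (tensor_linr ht _)) addrA subrK.
have w1 : `|w.1| <= `|x| + 1.
  rewrite -[w.1](subKr x); apply: le_trans (ler_normB _ _) _.
  by rewrite lerD2l ltW.
have -> : e = 8 * d * `|y| + 8 * (`|x| + 1) * d + 8 * d.
  by rewrite /d; field; rewrite gt_eqF// -addrA !addr_gt0// ltr_wpDl.
rewrite ltr_pwDr ?mulr_gt0//.
apply: le_trans (ler_normD _ _) _; apply: lerD.
  by apply: le_trans (norm_tensor _ _) _; rewrite ler_wpM2r// ler_wpM2l// ltW.
apply: le_trans (norm_tensor _ _) _; rewrite ler_pM ?mulr_ge0//; last exact: ltW.
by rewrite ler_wpM2l.
Qed.

End Bounds.

Lemma interior_tensor_extension (E F : corrType A) (D : hilbModType A)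
    (I J : Type) (s : I -> E) (t : J -> F) (m : I -> J -> D) :
  total_family s -> total_family t -> total_family (fun ij => m ij.1 ij.2) ->
  (forall i j i' j',
     dot (m i j) (m i' j') = dot (t j) (lact (dot (s i) (s i') : A) (t j')) :> A) ->
  exists M : E -> F -> D, interior_tensor M /\ forall i j, M (s i) (t j) = m i j.
Proof.
move=> tots tott totm mdot.
have lact_lin (a : A) (G : corrType A) : linear (lact a : G -> G) := (bounded_lactr a).1.
(* For fixed [i], the squared norm of a combination of the [m i j] is that of
   [dot y (lact (dot (s i) (s i)) y)], where [y] is the same combination of the [t j];
   [norm_lact_dot] bounds it. *)
have /choice[T hT] : forall i, exists Ti : F -> D, [/\ linear Ti,
    forall y, `|Ti y| <= 8 * `|s i| * `|y| & forall j, Ti (t j) = m i j].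
  move=> i; apply: bounded_extension => // l.
  rewrite -(@ler_pXn2r _ 2)// ?nnegrE ?mulr_ge0//.
  apply: le_trans (norm_lact_dot _ _); rewrite (dot_norm (A := A)) !dot_combl.
  rewrite le_eqVlt; apply/orP; left; apply/eqP; congr `|_|.
  apply: eq_bigr => ki _; rewrite (linear_comb _ _ (lact_lin _ _)) !dot_comb.
  by congr (_ *: _); apply: eq_bigr => kj _; rewrite mdot.
have bT i : bounded_linear (T i).
  by have [Tl Tb _] := hT i; split=> //; exists (8 * `|s i|) => //; exact: mulr_ge0.
have Tm i j : T i (t j) = m i j by have [_ _] := hT i.
have Tdot i i' y y' :
    dot (T i y) (T i' y') = dot y (lact (dot (s i) (s i') : A) y') :> A.
  have step j : dot (m i j) \o T i' =1
      (dot (t j) \o lact (dot (s i) (s i') : A) : F -> A).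
    apply: bounded_linear_eq tott _.
    - exact: (bounded_linear_comp (bounded_dot _) (bT _)).
    - exact: (bounded_linear_comp (bounded_dot _) (bounded_lactr _)).
    - by move=> j' /=; rewrite Tm mdot.
  rewrite -[LHS]dot_star -[RHS]dot_star lact_adj; congr star; move: y.
  change (dot (T i' y') \o T i =1
    (dot y' \o lact (star (dot (s i) (s i') : A)) : F -> A)).
  apply: bounded_linear_eq tott _.
  - exact: (bounded_linear_comp (bounded_dot _) (bT _)).
  - exact: (bounded_linear_comp (bounded_dot _) (bounded_lactr _)).
  move=> j /=; rewrite -[LHS]dot_star -lact_adj -[RHS]dot_star; congr star.
  by rewrite Tm; exact: step.
(* The second extension, now in the first variable with [y] fixed; [Tdot] supplies the inner
   products for its bound. *)
have /choice[S hS] : forall y, exists Sy : E -> D, [/\ linear Sy,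
    forall x, `|Sy x| <= 8 * `|y| * `|x| & forall i, Sy (s i) = T i y].
  move=> y; apply: bounded_extension => // l.
  rewrite -(@ler_pXn2r _ 2)// ?nnegrE ?mulr_ge0// mulrAC.
  apply: le_trans (norm_lact_dot _ _); rewrite (dot_norm (A := A)) dot_combl.
  rewrite le_eqVlt; apply/orP; left; apply/eqP; congr `|_|.
  rewrite -/(comb s l).
  have glin : linear (fun a : A => dot y (lact a y) : A).
    by move=> k a b; rewrite lactDl lactZl dotDr dotZr.
  rewrite dot_combl (lin_sum glin); apply: eq_bigr => ki _; congr (_ *: _).
  rewrite !dot_comb (linear_comb _ _ glin).
  by apply: eq_bigr => kj _ /=; rewrite Tdot.
have bS y : bounded_linear (S y).
  by have [Sl Sb _] := hS y; split=> //; exists (8 * `|y|) => //; exact: mulr_ge0.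
have Ss y i : S y (s i) = T i y by have [_ _] := hS y.
have Sdot x y x' y' : dot (S y x) (S y' x') = dot y (lact (dot x x' : A) y') :> A.
  have step i : dot (T i y) \o S y' =1
      ((fun a => dot y (lact a y')) \o dot (s i) : E -> A).
    apply: bounded_linear_eq tots _.
    - exact: (bounded_linear_comp (bounded_dot _) (bS _)).
    - apply: (bounded_linear_comp _ (bounded_dot _)).
      exact: (bounded_linear_comp (bounded_dot _) (bounded_lactl _)).
    - by move=> i' /=; rewrite Ss Tdot.
  rewrite -[LHS]dot_star -[RHS]dot_star lact_adj (dot_star x x'); congr star; move: x.
  change (dot (S y' x') \o S y =1
    ((fun a => dot y' (lact a y)) \o dot x' : E -> A)).
  apply: bounded_linear_eq tots _.
  - exact: (bounded_linear_comp (bounded_dot _) (bS _)).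
  - apply: (bounded_linear_comp _ (bounded_dot _)).
    exact: (bounded_linear_comp (bounded_dot _) (bounded_lactl _)).
  move=> i /=; rewrite -[LHS]dot_star -(dot_star (s i)) -lact_adj -[RHS]dot_star.
  by congr star; rewrite Ss; exact: step.
exists (fun x y => S y x); split=> [|i j]; last by rewrite Ss Tm.
have dot_mS i j x y : dot (m i j) (S y x) = dot (t j) (lact (dot (s i) x : A) y) :> A.
  by rewrite -Tm -Ss Sdot.
split.
- by move=> y; have [] := bS y.
(* The maps [S y] were chosen separately for each [y], so linearity in [y] has to be recovered by
   testing against the total family [m i j]. *)
- move=> x k y y'; apply: (dot_total totm) => -[i j] /=.
  by rewrite dotDr dotZr !dot_mS lactDr lactZr dotDr dotZr.
- move=> x a y; apply: (dot_total totm) => -[i j] /=.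
  by rewrite !dot_mS dot_ract lactM.
- move=> x y a; apply: (dot_total totm) => -[i j] /=.
  by rewrite dot_ract !dot_mS lact_ract dot_ract.
- by move=> x y x' y'; rewrite Sdot.
apply/(total_familyP (uncurry_range _)) => w e e0.
have [l hl] := totm w e e0.
exists [seq (kij.1, (s kij.2.1, t kij.2.2)) | kij <- l].
rewrite /comb big_map /= (eq_bigr (fun kij => kij.1 *: m kij.2.1 kij.2.2))//.
by move=> kij _; rewrite Ss Tm.
Qed.

End TensorExtension.

(** * The product system Z *)

(** Products are treated one factor at a time by bounded multiplication maps. The star is
    conjugate-linear, so [closed_span_map] does not cover it and approximants are starred
    directly. *)
Lemma closed_star_subalgebra_span (R : realType) (B : cstarAlgType R) I (s : I -> B) :
  (forall i j, exists k, s i ** s j = s k) -> (forall i, exists k, star (s i) = s k) ->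
  closed_star_subalgebra (closed_span s).
Proof.
move=> sM sS; split.
- rewrite closure_id eqEsubset; split; first exact: subset_closure.
  move=> x hx; apply: closed_span_lim => e e0.
  have [y [hy]] := hx _ (nbhsx_ballx x e e0).
  by rewrite -ball_normE /= => xy; exists y.
- by move=> k a b; exact: closed_span_lin.
- move=> a b ha hb.
  have bl c : bounded_linear (fun d : B => d ** c).
    split; first by move=> k d d'; rewrite cmulDl cmulZl.
    by exists `|c| => // d; rewrite mulrC cnormM.
  have br c : bounded_linear (cmul c : B -> B).
    split; first by move=> k d d'; rewrite cmulDr cmulZr.
    by exists `|c| => // d; exact: cnormM.
  apply: closed_span_map (br a) _ hb => j.
  apply: (closed_span_map (bl (s j)) _ ha) => i.
  by have [k ->] := sM i j; exact: closed_span_mem.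
- move=> a ha; apply: closed_span_lim => e e0; have [l hl] := ha e e0.
  exists (star (comb s l)); last by rewrite -starB norm_star.
  elim: l {hl} => [|ki l IH]; first by rewrite comb_nil star0; exact: closed_span0.
  rewrite comb_cons star_linear_conj; apply: closed_span_lin => //.
  by have [k ->] := sS ki.2; exact: closed_span_mem.
Qed.

(** * Moving elements between fibres over equal indices *)

Section Transport.
Context {R : realType} {A : cstarAlgType R} {P : Type} {X : P -> corrType A}.

(** An equation in the disjoint union becomes one inside a single fibre, where linearity and density
    make sense. *)
Definition transport p q (e : p = q) (x : X p) : X q :=
  eq_rect p (fun r => X r : Type) x q e.

Lemma tot_transport p q (e : p = q) (x : X p) : tot X (transport e x) = tot X x.
Proof. by case: _ / e. Qed.

Lemma tot_congr (W : Type) (f : forall p, X p -> W) p q (x : X p) (y : X q) :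
  tot X x = tot X y -> f p x = f q y.
Proof. exact: (congr1 (fun w => f (projT1 w) (projT2 w))). Qed.

Lemma tot_transportP p q (e : p = q) (x : X p) (y : X q) :
  tot X x = tot X y -> transport e x = y.
Proof.
(* Quantifying over all proofs [e'] allows rewriting along [H]; what remains is a proof of [q = q],
   trivial by proof irrelevance. *)
move=> H; have H' := tot_congr (fun r (w : X r) => forall e' : r = q, transport e' w = y) H.
suff : forall e' : q = q, transport e' y = y by rewrite -H'.
by move=> e'; rewrite (Prop_irrelevance e' erefl).
Qed.

Lemma tot_inj p (x y : X p) : tot X x = tot X y -> x = y.
Proof. exact: (tot_transportP erefl). Qed.

Lemma bounded_transport p q (e : p = q) : bounded_linear (transport e).
Proof. by case: _ / e; split=> //; exists 1 => // x; rewrite mul1r. Qed.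

Lemma transport_dot p q (e : p = q) (x y : X p) :
  dot (transport e x) (transport e y) = dot x y :> A.
Proof. by case: _ / e. Qed.

Lemma transport_lact p q (e : p = q) a (x : X p) :
  transport e (lact a x) = lact a (transport e x).
Proof. by case: _ / e. Qed.

End Transport.

(** * The action of [G] on single fibres of [X] *)

Section CrossedProductSystem.
Context {R : realType} {P : monoidType} {G : groupType}.
Context {act : G -> P -> P} {res : P -> G -> G} {A : cstarAlgType R}.
Context {X : P -> corrType A} {mulX : forall p q, X p -> X q -> X (p * q)%g}.
Context {unitX : selfcorr A -> X 1%g}.
Context {beta : forall g p, X p -> X (act g p)} {alpha : G -> A -> A}.
Hypothesis hPG : zappa_szep act res.
Hypothesis hX : product_system mulX unitX.
Hypothesis hbeta : zs_action res mulX unitX beta alpha.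
Hypothesis hhom : homogeneous act.

Let mulX_tensor p q : interior_tensor (@mulX p q).
Proof. by apply/extends_to_unitaryP; exact: (ps_unitary hX p q). Qed.

Definition fiber_act g p (x : X p) : X p := transport (hhom g p) (beta g x).
Local Notation b := fiber_act.

Lemma tot_fiber_act g p (x : X p) : tot X (b g x) = tot X (beta g x).
Proof. exact: tot_transport. Qed.

Lemma fiber_actM g h p (x : X p) : b g (b h x) = b (g * h)%g x.
Proof.
apply: tot_inj; rewrite !tot_fiber_act -(zsa_comp hbeta).
exact: (tot_congr (fun q (w : X q) => tot X (beta g w)) (tot_fiber_act h x)).
Qed.

Lemma fiber_act1 p (x : X p) : b 1%g x = x.
Proof. by apply: tot_inj; rewrite tot_fiber_act (zsa_id hbeta). Qed.

Lemma fiber_actK g p (x : X p) : b g^-1%g (b g x) = x.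
Proof. by rewrite fiber_actM mulVg fiber_act1. Qed.

Lemma fiber_act_unit g a : b g (unitX a) = unitX (alpha g a).
Proof. by apply: tot_inj; rewrite tot_fiber_act (zsa_coef hbeta). Qed.

Lemma fiber_act_mul g p q (x : X p) (y : X q) :
  b g (mulX x y) = mulX (b g x) (b (res p g) y).
Proof.
apply: tot_inj; rewrite tot_fiber_act (zsa_mul hbeta).
rewrite (tot_congr (fun r (w : X r) => tot X (mulX w (beta (res p g) y)))
  (esym (tot_fiber_act g x))).
exact: (tot_congr (fun r (w : X r) => tot X (mulX (b g x) w))
  (esym (tot_fiber_act _ y))).
Qed.

Lemma fiber_act_dot g p (x y : X p) :
  dot (b g x) (b g y) = alpha (res p g) (dot x y) :> A.
Proof. by rewrite transport_dot (zsa_dot hbeta). Qed.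

(** The left action is multiplication by [unitX a], and [g|_e = g], so this is an instance of
    multiplicativity. *)
Lemma fiber_act_lact g p a (x : X p) : b g (lact a x) = lact (alpha g a) (b g x).
Proof.
apply: tot_inj; rewrite -(tot_congr (fun q (w : X q) => tot X (b g w)) (ps_lact hX a x)).
by rewrite fiber_act_mul fiber_act_unit (zs_res_e hPG) (ps_lact hX).
Qed.

Lemma alphaM g h a : alpha g (alpha h a) = alpha (g * h)%g a.
Proof.
have [[V [_ unitK _]] _] := ps_unit hX.
by rewrite -[LHS]unitK -[RHS]unitK -!fiber_act_unit fiber_actM.
Qed.

(** By homogeneity [g |-> g|_p] is a group homomorphism. *)
Lemma resV p g : res p g^-1%g = (res p g)^-1%g.
Proof.
have := zs_resM hPG g^-1%g g p; rewrite mulVg (zs_res1 hPG) hhom => H.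
by apply/esym/(mulIg (res p g)); rewrite -H mulVg.
Qed.

(** * Generators of the crossed product and elementary tensors of [Z] *)

Context {AG : cstarAlgType R} {iota : A -> AG} {u : G -> AG}.
Hypothesis hAG : crossed_product alpha iota u.
Context {Z : P -> corrType AG} {z : forall p, X p -> G -> Z p}.
Hypothesis hZ : crossed_correspondences res beta alpha iota u z.

Let hcov : covariant alpha iota u := cp_covariant hAG.

Lemma crossed_gen_mul a g a' g' :
  (iota a ** u g) ** (iota a' ** u g') = iota (a ** alpha g a') ** u (g * g')%g.
Proof.
rewrite (star_hom_mul (cov_hom hcov)) (cov_mul hcov).
by rewrite -!cmulA [u g ** _]cmulA (cov_eq hcov) !cmulA.
Qed.

Lemma crossed_gen_star a g :
  star (iota a ** u g) = iota (alpha g^-1%g (star a)) ** u g^-1%g.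
Proof.
by rewrite starM (cov_star hcov) -(star_hom_star (cov_hom hcov)) (cov_eq hcov).
Qed.

(** The closed span of the elements [iota a ** u g] is a closed star-subalgebra containing the
    generators, hence everything. *)
Lemma crossed_gen_total : total_family (fun ag : A * G => iota ag.1 ** u ag.2).
Proof.
move=> x; suff -> : closed_span (fun ag : A * G => iota ag.1 ** u ag.2) = setT by [].
apply: (cp_generated hAG); first apply: closed_star_subalgebra_span.
- move=> [a g] [a' g']; exists (a ** alpha g a', (g * g')%g); exact: crossed_gen_mul.
- move=> [a g]; exists (alpha g^-1%g (star a), g^-1%g); exact: crossed_gen_star.
- move=> a; have := closed_span_mem (fun ag : A * G => iota ag.1 ** u ag.2) (a, 1%g).
  by rewrite /= (cov_one hcov) cmul1r.
- move=> g; have := closed_span_mem (fun ag : A * G => iota ag.1 ** u ag.2) (cone, g).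
  by rewrite /= (star_hom_one (cov_hom hcov)) cmul1l.
Qed.

Lemma z_total p : total_family (fun xg : X p * G => z xg.1 xg.2).
Proof. exact: (total_familyP (uncurry_range (@z p))).1 (zc_total hZ p). Qed.

Lemma z_lact a h p (x : X p) g :
  lact (iota a ** u h) (z x g) = z (lact a (b h x)) (res p h * g)%g.
Proof.
apply: tot_inj; rewrite (zc_lact hZ).
apply: (tot_congr (fun q (w : X q) => tot Z (z w _))).
by rewrite /fiber_act -transport_lact tot_transport.
Qed.

(** The squared norm of [z x g] is that of [iota (alpha g^-1 (dot x x))]; each of the two
    star-homomorphisms costs a factor 4. *)
Lemma bounded_z p g : bounded_linear (fun x : X p => z x g).
Proof.
split; first exact: (zc_linear hZ g).
exists 4 => // x; rewrite -(@ler_pXn2r _ 2)// ?nnegrE ?mulr_ge0//.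
rewrite (dot_norm (A := AG)) (zc_dot hZ) mulVg (cov_one hcov) cmul1r.
apply: le_trans (norm_star_hom _ (cov_hom hcov)) _.
rewrite exprMn (dot_norm (A := A)) expr2 -mulrA ler_pM2l//.
exact: (norm_star_hom _ (zsa_aut hbeta _).1).
Qed.

(** The key computation. By [resV], applying [alpha] at the inverse of [g|_q] to an inner product in
    [X q] amounts to applying [b g^-1] to both entries: this cancels [b g] on [y] and turns [b g']
    into [b (g^-1 * g')], while the group parts combine to [(g^-1 g')|_q]. *)
Lemma z_mul_dot p q (x x' : X p) (y y' : X q) g g' h h' :
  dot (z (mulX x (b g y)) (res q g * h)%g)
      (z (mulX x' (b g' y')) (res q g' * h')%g) =
  dot (z y h) (lact (dot (z x g) (z x' g') : AG) (z y' h')) :> AG.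
Proof.
rewrite !(zc_dot hZ) z_lact (zc_dot hZ) (tensor_dot (mulX_tensor p q)).
rewrite invgM -alphaM -resV -fiber_act_dot fiber_actK fiber_act_lact fiber_actM.
by rewrite (zs_resM hPG) hhom !mulgA.
Qed.

(** The products of [z x 1] with [z y k] suffice: they equal [z (mulX x y) k], and the elements
    [mulX x y] are total in the fibre over [p * q]. *)
Lemma z_mul_total p q : total_family (fun ij : (X p * G) * (X q * G) =>
  z (mulX ij.1.1 (b ij.1.2 ij.2.1)) (res q ij.1.2 * ij.2.2)%g).
Proof.
set m := fun _ => _; move=> w.
apply: (closed_span_map (bounded_id _) _ (z_total w)) => -[v k] /=.
have := interior_tensor_total (mulX_tensor p q) v.
apply: (closed_span_map (bounded_z _ k)) => -[x y] /=.
have := closed_span_mem m ((x, 1%g), (y, k)).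
by rewrite /m /= fiber_act1 (zs_res1 hPG) mul1g.
Qed.

Lemma crossed_mul_exists p q : exists M : Z p -> Z q -> Z (p * q)%g,
  interior_tensor M /\ forall x g y h,
    M (z x g) (z y h) = z (mulX x (b g y)) (res q g * h)%g.
Proof.
have [|M [hM Mz]] := interior_tensor_extension (@z_total p) (@z_total q)
    (m := fun i j => z (mulX i.1 (b i.2 j.1)) (res q i.2 * j.2)%g) (@z_mul_total p q).
  by move=> [x g] [y h] [x' g'] [y' h']; exact: z_mul_dot.
by exists M; split=> // x g y h; exact: (Mz (x, g) (y, h)).
Qed.

Lemma crossed_unit_exists : exists U : selfcorr AG -> Z 1%g,
  corr_iso U /\ forall a g, U (iota a ** u g) = z (unitX a) g.
Proof.
have [hU lactU] := ps_unit hX; have Ulin := unitary_linear hU.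
have tot1 : total_family (fun ag : A * G => z (unitX ag.1) ag.2).
  have [V [_ UK VK]] := hU => w.
  apply: (closed_span_map (bounded_id _) _ (z_total w)) => -[v k] /=; rewrite -[v]VK.
  exact: (closed_span_mem (fun ag : A * G => z (unitX ag.1) ag.2) (V v, k)).
have [|U [hU' Uz]] := unitary_extension (E := selfcorr AG) crossed_gen_total tot1.
  move=> [a g] [a' g'] /=; rewrite (zc_dot hZ) (unitary_dot hU).
  change (star (iota a ** u g) ** (iota a' ** u g') =
    iota (alpha g^-1%g (star a ** a')) ** u (g^-1 * g')%g).
  by rewrite crossed_gen_star crossed_gen_mul (star_hom_mul (zsa_aut hbeta _).1).
exists U; split; last by move=> a g; exact: (Uz (a, g)).
have bU := bounded_unitary hU'.
(* Compatibility with the left action is first shown for a generator acting on anything, then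
   extended to all coefficients. *)
have lact_gen a g : U \o lact (iota a ** u g) =1 lact (iota a ** u g) \o U.
  apply: (bounded_linear_eq _ _ crossed_gen_total).
  - exact: (bounded_linear_comp bU (bounded_lactr _)).
  - exact: (bounded_linear_comp (bounded_lactr _) bU).
  move=> [a' g'] /=; rewrite [lact _ _]crossed_gen_mul (Uz (a', g')) z_lact.
  by rewrite (Uz (_, _)) fiber_act_unit -lactU (zs_res_e hPG).
split=> // c x; move: c; change (U \o (fun c => lact c x) =1 (fun c => lact c (U x))).
apply: (bounded_linear_eq _ _ crossed_gen_total).
- exact: (bounded_linear_comp bU (bounded_lactl _)).
- exact: bounded_lactl.
- by move=> [a g]; exact: lact_gen.
Qed.

(** * The product system axioms for a multiplication prescribed on elementary tensors *)

Section ProductSystem.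
Context {mulZ : forall p q, Z p -> Z q -> Z (p * q)%g} {unitZ : selfcorr AG -> Z 1%g}.
Hypothesis mulZ_tensor : forall p q, interior_tensor (@mulZ p q).
Hypothesis mulZE : forall p q (x : X p) g (y : X q) h,
  mulZ (z x g) (z y h) = z (mulX x (b g y)) (res q g * h)%g.
Hypothesis unitZ_iso : corr_iso unitZ.
Hypothesis unitZE : forall a g, unitZ (iota a ** u g) = z (unitX a) g.

Let bl p q (y : Z q) := bounded_tensorl (mulZ_tensor p q) y.
Let br p q (x : Z p) := bounded_tensorr (mulZ_tensor p q) x.

(** Three density arguments, in [x], [y] and [w], reduce to elementary tensors. There the group
    parts agree because [(g|_q h)|_r = g|_{qr} h|_r] in the homogeneous case. *)
Lemma crossed_mul_assoc p q r (x : Z p) (y : Z q) (w : Z r) :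
  tot Z (mulZ x (mulZ y w)) = tot Z (mulZ (mulZ x y) w).
Proof.
pose e := mulgA p q r.
have be : bounded_linear (transport (X := Z) e) := bounded_transport e.
rewrite -(tot_transport e); congr (tot Z _); move: x.
change (transport e \o (@mulZ _ _ ^~ (mulZ y w)) =1
        (@mulZ _ _ ^~ w) \o (@mulZ _ _ ^~ y)).
apply: (bounded_linear_eq _ _ (@z_total p)).
- exact: (bounded_linear_comp be (bl _ _)).
- exact: (bounded_linear_comp (bl _ _) (bl _ _)).
move=> [x g]; move: y => /=.
change (transport e \o (mulZ (z x g) \o (@mulZ _ _ ^~ w)) =1
        (@mulZ _ _ ^~ w) \o mulZ (z x g)).
apply: (bounded_linear_eq _ _ (@z_total q)).
- exact: (bounded_linear_comp be (bounded_linear_comp (br _ _) (bl _ _))).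
- exact: (bounded_linear_comp (bl _ _) (br _ _)).
move=> [y h]; move: w => /=.
change (transport e \o (mulZ (z x g) \o mulZ (z y h)) =1 mulZ (mulZ (z x g) (z y h))).
apply: (bounded_linear_eq _ _ (@z_total r)).
- exact: (bounded_linear_comp be (bounded_linear_comp (br _ _) (br _ _))).
- exact: br.
move=> [w k] /=; rewrite !mulZE; apply: tot_transportP.
rewrite fiber_act_mul fiber_actM (zs_res_mul hPG) (zs_resM hPG) hhom.
rewrite (mulgA (res r (res q g))).
exact: (tot_congr (fun s (v : X s) => tot Z (z v _)) (ps_assoc hX _ _ _)).
Qed.

Lemma crossed_mul_lact p (a : AG) (x : Z p) :
  tot Z (mulZ (unitZ a) x) = tot Z (lact a x).
Proof.
pose e := mul1g p.
have be : bounded_linear (transport (X := Z) e) := bounded_transport e.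
have bU := bounded_unitary unitZ_iso.1.
rewrite -(tot_transport e); congr (tot Z _); move: a.
change (transport e \o ((@mulZ _ _ ^~ x) \o unitZ) =1 (fun a => lact a x)).
apply: (bounded_linear_eq _ _ crossed_gen_total).
- exact: (bounded_linear_comp be (bounded_linear_comp (bl _ _) bU)).
- exact: bounded_lactl.
move=> [a g]; move: x => /=; rewrite unitZE.
change (transport e \o mulZ (z (unitX a) g) =1 lact (iota a ** u g)).
apply: (bounded_linear_eq _ _ (@z_total p)).
- exact: (bounded_linear_comp be (br _ _)).
- exact: bounded_lactr.
move=> [x h] /=; rewrite mulZE z_lact; apply: tot_transportP.
exact: (tot_congr (fun s (v : X s) => tot Z (z v _)) (ps_lact hX _ _)).
Qed.

Lemma crossed_mul_ract p (x : Z p) (a : AG) :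
  tot Z (mulZ x (unitZ a)) = tot Z (ract x a).
Proof.
pose e := mulg1 p.
have be : bounded_linear (transport (X := Z) e) := bounded_transport e.
have bU := bounded_unitary unitZ_iso.1.
rewrite -(tot_transport e); congr (tot Z _); move: a.
change (transport e \o (mulZ x \o unitZ) =1 ract x).
apply: (bounded_linear_eq _ _ crossed_gen_total).
- exact: (bounded_linear_comp be (bounded_linear_comp (br _ _) bU)).
- exact: bounded_ractl.
move=> [a h]; move: x => /=; rewrite unitZE.
change (transport e \o (@mulZ _ _ ^~ (z (unitX a) h)) =1
        (fun x => ract x (iota a ** u h))).
apply: (bounded_linear_eq _ _ (@z_total p)).
- exact: (bounded_linear_comp be (bl _ _)).
- exact: bounded_ractr.
move=> [x g] /=; rewrite mulZE (zc_ract hZ) (zs_res_e hPG) fiber_act_unit.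
apply: tot_transportP.
exact: (tot_congr (fun s (v : X s) => tot Z (z v _)) (ps_ract hX _ _)).
Qed.

Lemma crossed_product_system : product_system mulZ unitZ.
Proof.
split; [exact: crossed_mul_assoc|exact: unitZ_iso|
  |exact: crossed_mul_lact|exact: crossed_mul_ract].
by move=> p q; exact/extends_to_unitaryP.
Qed.

Lemma tot_crossed_mul p q (x : X p) (y : X q) g h :
  tot Z (mulZ (z x g) (z y h)) = tot Z (z (mulX x (beta g y)) (res q g * h)%g).
Proof.
rewrite mulZE.
exact: (tot_congr (fun s (v : X s) => tot Z (z (mulX x v) _)) (tot_fiber_act g y)).
Qed.

End ProductSystem.
End CrossedProductSystem.

Unset Implicit Arguments.

Theorem theorem3p11 (R : realType) (P : monoidType) (G : groupType)
    (act : G -> P -> P) (res : P -> G -> G)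
    (hPG : zappa_szep act res)
    (A : cstarAlgType R)
    (X : P -> corrType A)
    (mulX : forall p q, X p -> X q -> X (p * q)%g)
    (unitX : selfcorr A -> X 1%g)
    (hX : product_system mulX unitX)
    (beta : forall g p, X p -> X (act g p)) (alpha : G -> A -> A)
    (hbeta : zs_action res mulX unitX beta alpha)
    (hhom : homogeneous act)
    (AG : cstarAlgType R) (iota : A -> AG) (u : G -> AG)
    (hAG : crossed_product alpha iota u)
    (Z : P -> corrType AG) (z : forall p, X p -> G -> Z p)
    (hZ : crossed_correspondences res beta alpha iota u z) :
  exists (mulZ : forall p q, Z p -> Z q -> Z (p * q)%g)
         (unitZ : selfcorr AG -> Z 1%g),
    [/\ product_system mulZ unitZ,
        forall (a : A) (g : G), unitZ (iota a ** u g) = z 1%g (unitX a) g,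
        forall (p q : P) (x : X p) (y : X q) (g h : G),
          tot Z (mulZ p q (z p x g) (z q y h)) =
          tot Z (z _ (mulX _ _ x (beta g q y)) (res q g * h)%g) &
        forall p q, continuous_bilinear (mulZ p q)].
Proof.
(* Existence is known for each pair [p], [q]; [cid] picks a witness, so that the multiplications
   form a family. *)
have M p q := cid (crossed_mul_exists hPG hX hbeta hhom hAG hZ p q).
have [unitZ [unitZ_iso unitZE]] := crossed_unit_exists hPG hX hbeta hhom hAG hZ.
pose mulZ p q := projT1 (M p q).
have mulZ_tensor p q : interior_tensor (mulZ p q) := (projT2 (M p q)).1.
have mulZE p q := (projT2 (M p q)).2.
exists mulZ, unitZ; split.
- exact: (crossed_product_system hPG hX hbeta hAG hZ mulZ_tensor mulZE unitZ_iso).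
- exact: unitZE.
- by move=> p q x y g h; exact: (tot_crossed_mul mulZE).
- by move=> p q; exact: interior_tensor_continuous.
Qed.
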